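(* Let $E$ be a rearrangement-invariant function space on $[0,1]$ with an absolutely continuous norm. Then there exists a complemented subspace $E_0$ of $E$, isomorphic to $E$, for which there are two projections of $E$ onto $E_0$, one of which is narrow and the second of which is not narrow at any measurable subset $B\subseteq[0,1]$ of positive measure.
   Context: $\mu$ is Lebesgue measure on $[0,1]$. A Köthe function space $X$ on $([0,1],\mu)$ is a Banach space of (classes of) locally integrable Borel functions such that (1) if $|f|\le|g|$ a.e. and $g\in X$ then $f\in X$ and $\|f\|_X\le\|g\|_X$; (2) $\chi_A\in X$ for every Borel set $A$ of finite measure. $X$ is order-continuous if $f_n\downarrow 0$ a.e. with $f_n \in X$ implies $\|f_n\|_X\downarrow0$ (for these spaces this is what is meant by an absolutely continuous norm); it has the Fatou property if $0\le f_n\in X$, $\sup_n\|f_n\|_X<\infty$, $f_n\uparrow f$ a.e. imply $f\in X$ and $\|f\|_X=\sup_n\|f_n\|_X$. A rearrangement-invariant (r.i.) space is a Köthe function space $X$ on $([0,1],\mu)$ such that: (1) $X$ is order-continuous or has the Fatou property; (2) for every measure-preserving invertible Borel automorphism $\tau$ of $[0,1]$, $f\in X$ iff $f\circ\tau\in X$, and then $\|f\|_X=\|f\circ\tau\|_X$; (3) $\|\chi_{[0,1]}\|_X=1$. A bounded linear operator $T:X\to Y$ from an r.i. space $X$ to a Banach space $Y$ is narrow if for each measurable set $A$ and each $\varepsilon>0$ there is $x\in X$ with $x^2=\chi_A$, $\int x\,d\mu=0$ and $\|Tx\|<\varepsilon$. An operator $T$ on $E$ is narrow at a measurable subset $B\subseteq[0,1]$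 if the operator $x\mapsto T(x\cdot\chi_B)$ is narrow. A projection is a bounded linear idempotent operator. *)

(* Defs.v *)
From HB Require Import structures.
From mathcomp Require Import all_boot all_order all_algebra.
From mathcomp Require Import all_classical all_reals all_analysis measurable_realfun.
Set Implicit Arguments.
Unset Strict Implicit.
Unset Printing Implicit Defensive.
Import Order.TTheory GRing.Theory Num.Theory.
Import numFieldNormedType.Exports.
Local Open Scope classical_set_scope.
Local Open Scope ring_scope.

Definition unit_itv (R : realType) : set R := `[0, 1]%classic.
Notation I01 := (@unit_itv _).
Notation mu := (@lebesgue_measure _).

(* A Banach space [E] of classes of functions on [0, 1] is given by a map
   [fn : E -> R -> R] that picks a representative of each class; only the values
   of [fn x] on [0, 1], up to a null set, are ever used. *)
Section function_spaces.
Context {R : realType} {E : completeNormedModType R}.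
Variable fn : E -> R -> R.

Definition represents (x : E) (f : R -> R) : Prop :=
  measurable_fun I01 f /\ ae_eq mu I01 (fn x) f.

Definition belongs (f : R -> R) : Prop := exists x, represents x f.

(* As [0, 1] is compact and of finite measure, locally integrable functions on
   it are the integrable ones. *)
Record kothe_space : Prop := {
  kothe_integrable : forall x, mu.-integrable I01 (EFin \o fn x) ;
  kothe_linear : forall (a : R) (x y : E),
    ae_eq mu I01 (fn (a *: x + y)) (fun t => a * fn x t + fn y t) ;
  kothe_inj : forall x y, ae_eq mu I01 (fn x) (fn y) -> x = y ;
  kothe_solid : forall (f : R -> R) (y : E), measurable_fun I01 f ->
    {ae mu, forall t, I01 t -> `|f t| <= `|fn y t|} ->
    exists2 x, represents x f & `|x| <= `|y| ;
  kothe_indic : forall A : set R, measurable A -> A `<=` I01 ->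
    (mu A < +oo)%E -> belongs \1_A
}.

Definition order_continuous : Prop :=
  forall x : nat -> E,
    {ae mu, forall t, I01 t ->
      nonincreasing_seq (fun n => fn (x n) t) /\
      (fun n => fn (x n) t) @ \oo --> (0 : R)} ->
    nonincreasing_seq (fun n => `|x n|) /\
    (fun n => `|x n|) @ \oo --> (0 : R).

Definition fatou_property : Prop :=
  forall (x : nat -> E) (f : R -> R), measurable_fun I01 f ->
    {ae mu, forall t, I01 t -> forall n, 0 <= fn (x n) t} ->
    has_ubound (range (fun n => `|x n|)) ->
    {ae mu, forall t, I01 t ->
      nondecreasing_seq (fun n => fn (x n) t) /\
      (fun n => fn (x n) t) @ \oo --> f t} ->
    exists2 y, represents y f & `|y| = sup (range (fun n => `|x n|)).

Definition mp_automorphism (tau : R -> R) : Prop :=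
  [/\ set_bij I01 I01 tau,
      measurable_fun I01 tau,
      forall A : set R, measurable A -> A `<=` I01 -> measurable (tau @` A) &
      forall A : set R, measurable A -> A `<=` I01 ->
        mu (I01 `&` tau @^-1` A) = mu A].

Record ri_space : Prop := {
  ri_kothe : kothe_space ;
  ri_oc_or_fatou : order_continuous \/ fatou_property ;
  ri_invariant : forall tau, mp_automorphism tau ->
    forall f : R -> R, measurable_fun I01 f ->
      (belongs f <-> belongs (f \o tau)) /\
      (forall x y, represents x f -> represents y (f \o tau) -> `|x| = `|y|) ;
  ri_normalized : forall x, represents x \1_I01 -> `|x| = 1
}.

Definition narrow (Y : completeNormedModType R) (T : E -> Y) : Prop :=
  forall A : set R, measurable A -> A `<=` I01 ->
  forall e : R, 0 < e ->
  exists x : E,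
    [/\ ae_eq mu I01 (fun t => fn x t ^+ 2) \1_A,
        (\int[mu]_(t in I01) (fn x t)%:E = 0)%E &
        `|T x| < e].

(* The element [x * chi_B] of [E]; by [kothe_solid] and [kothe_inj] it exists
   and is unique, so the default value [0] is not used. *)
Definition cutoff (B : set R) (x : E) : E :=
  xget 0 [set y | represents y (fun t => fn x t * \1_B t)].

Lemma cutoff_represents (B : set R) (x : E) :
  kothe_space -> measurable B ->
  represents (cutoff B x) (fun t => fn x t * \1_B t).
Proof.
move=> kE mB; rewrite /cutoff; case: xgetP => [y _ //|nex].
have mf : measurable_fun I01 (fun t => fn x t * \1_B t).
  apply: measurable_funM; last exact: measurable_indic.
  by apply/measurable_EFinP; have /integrableP[] := kothe_integrable kE x.
have [|y yf _] := @kothe_solid kE (fun t => fn x t * \1_B t) x mf.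
  apply: aeW => t _; rewrite normrM indicE ler_piMr//.
  by case: (t \in B); rewrite ?normr1 ?normr0.
by case: (nex y).
Qed.

Definition narrow_at (Y : completeNormedModType R) (T : E -> Y) (B : set R) :
    Prop :=
  narrow (fun x => T (cutoff B x)).

End function_spaces.

Section operators.
Context {R : realType}.

(* For linear maps, boundedness near [0] is boundedness in operator norm, see
   [linear_boundedP]. *)
Definition projection_onto (V : normedModType R) (P : {linear V -> V})
    (F : set V) : Prop :=
  [/\ bounded_near P (nbhs (0 : V)), forall x, P (P x) = P x & range P = F].

Definition complemented (V : normedModType R) (F : set V) : Prop :=
  exists P : {linear V -> V}, projection_onto P F.

Definition isomorphic_subspace (V W : normedModType R) (F : set W) : Prop :=
  exists (J : {linear V -> W}) (K : W -> V),
    [/\ continuous J, range J = F, cancel J K & {within F, continuous K}].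

End operators.

(* Main.v *)
(** Let [F_p] be the isometry of [E] induced by flipping the [p]-th binary digit
    of [t], and [S_pq] the one induced by exchanging digits [p] and [q]. By order
    continuity, the functions depending on finitely many digits are dense in [E],
    so infinite products of such operators converge strongly as soon as their
    tails act trivially on functions of finitely many digits. This yields an
    isometric embedding [J], which moves digit [n] to position [2 n + 1], and a
    contraction [K] with [K J = 1], which averages over the digits of even position
    and then moves digit [2 n + 1] to position [n]. Put [E0 = J E].

    - [P = J K] is a projection onto [E0] which kills [r_p 1_A] whenever [p] is
      even and [A] is invariant under flipping digit [p], where [r_p] is the [p]-th
      Rademacher function; hence it is narrow.
    - [Q = P + 3 J (1 - P) = J (K + 3 - 3 J K)] is a projection onto [E0]. If
      [x ^ 2 = 1_A] with [A] contained in one of the two sets where digit [0] is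
      constant, then [|K x| <= 1/2] and [|J K x| <= 1/2], so that
      [|K x + 3 x - 3 J K x| >= |x|] and [||Q x|| >= ||x||]. *)
Require Import Defs.
From HB Require Import structures.
From mathcomp Require Import all_boot all_order all_algebra.
From mathcomp Require Import all_classical all_reals all_analysis.
From mathcomp Require Import measurable_realfun.
From mathcomp Require Import zify lra.
Set Implicit Arguments.
Unset Strict Implicit.
Unset Printing Implicit Defensive.
Import Order.TTheory GRing.Theory Num.Theory.
Import numFieldNormedType.Exports.
Local Open Scope classical_set_scope.
Local Open Scope ring_scope.

Lemma bounded_near_le {R : realType} {V W : normedModType R}
    (f : {linear V -> W}) (c : R) :
  (forall x : V, `|f x| <= c * `|x|) -> bounded_near f (nbhs (0 : V)).
Proof.
move=> fc; apply/linear_boundedP; near=> r => x; apply: le_trans (fc x) _.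
by rewrite ler_wpM2r//; near: r; exact: nbhs_pinfty_ge.
Unshelve. all: by end_near. Qed.

(** * Strong limits of contractions *)
Section strong_limits.
Context {R : realType} {V : completeNormedModType R}.

Definition dense_in_norm (D : set V) :=
  forall (x : V) (e : R), 0 < e -> exists2 s, D s & `|x - s| < e.

(** Bundles an operator known only to satisfy [linear], so that the rewriting lemmas for
    [{linear V -> V}] apply to it. *)
Lemma linear_of_prop (T : V -> V) : linear T ->
  exists L : {linear V -> V}, L =1 T.
Proof.
move=> linT.
pose H := GRing.isLinear.Build R V V *:%R T linT.
by exists (HB.pack_for {linear V -> V} T H).
Qed.

Lemma contractive_dist (T : V -> V) (x y : V) :
  linear T -> (forall z, `|T z| <= `|z|) -> `|T x - T y| <= `|x - y|.
Proof.
move=> /linear_of_prop[L LT] cT.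
by rewrite -!LT -linearB LT.
Qed.

(** On [D] the sequence is eventually constant; contractivity carries the Cauchy property to all of
    [V], and a pointwise limit of linear maps is linear. *)
Lemma strong_limit (T : nat -> V -> V) (D : set V) :
  (forall n, linear (T n)) -> (forall n x, `|T n x| <= `|x|) ->
  dense_in_norm D ->
  (forall s, D s -> exists N, forall n, (N <= n)%N -> T n s = T N s) ->
  exists L : {linear V -> V}, forall x, T n x @[n --> \oo] --> L x.
Proof.
move=> linT cT dD stT.
have cvgT x : cvg (T n x @[n --> \oo]).
  apply/cauchy_cvgP/cauchy_exP => e e0.
  have [s Ds xs] := dD x (e / 2) (divr_gt0 e0 (ltr0Sn _ _)).
  have [N TN] := stT s Ds.
  exists (T N s); exists N => // n /= Nn.
  rewrite -ball_normE /ball_/= -(TN _ Nn) distrC.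
  apply: le_lt_trans (contractive_dist x s (linT n) (cT n)) _.
  by apply: lt_le_trans xs _; lra.
have limT : linear (fun x => lim (T n x @[n --> \oo])).
  move=> a x y; apply/cvg_lim => //.
  under eq_fun do rewrite linT.
  apply: cvgD; last exact: cvgT.
  by apply: cvgZr; exact: cvgT.
have [L LE] := linear_of_prop limT.
by exists L => x; rewrite LE; exact: cvgT.
Qed.

(** The difference [S - T] takes the same value at [x] and at [x - s] for [s] in [D], and its norm
    there is at most twice that of [x - s]. *)
Lemma dense_eq (S T : {linear V -> V}) (D : set V) :
  (forall x, `|S x| <= `|x|) -> (forall x, `|T x| <= `|x|) ->
  dense_in_norm D -> (forall s, D s -> S s = T s) -> S =1 T.
Proof.
move=> cS cT dD eST x; apply/eqP; rewrite -subr_eq0 -normr_le0.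
apply/ler_addgt0Pr => e e0; rewrite add0r.
have [s Ds xs] := dD x (e / 2) (divr_gt0 e0 (ltr0Sn _ _)).
have -> : S x - T x = S (x - s) - T (x - s).
  by rewrite !linearB/= (eST _ Ds) opprK addrACA addNr addr0.
apply: le_trans (ler_normB _ _) _.
have := cS (x - s); have := cT (x - s); lra.
Qed.

End strong_limits.

(* [F p] and [S p q] stand for the actions on functions of flipping the [p]-th
   binary digit and of exchanging the [p]-th and [q]-th digits; [fixed_from n]
   is the set of functions of the first [n] digits. *)
Section digit_operators.
Context {R : realType} {V : completeNormedModType R}.
Variables (F : nat -> V -> V) (S : nat -> nat -> V -> V).

Definition fixed_from (n : nat) : set V := [set x | forall p, (n <= p)%N -> F p x = x].

Hypotheses (linF : forall p, linear (F p)) (linS : forall p q, linear (S p q)).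
Hypotheses (normF : forall p x, `|F p x| = `|x|)
           (normS : forall p q x, `|S p q x| = `|x|).
Hypothesis FK : forall p x, F p (F p x) = x.
Hypothesis FC : forall p q x, F p (F q x) = F q (F p x).
Hypothesis SK : forall p q x, p != q -> S p q (S p q x) = x.
Hypothesis FS : forall p q r x, p != q -> r != p -> r != q ->
  F r (S p q x) = S p q (F r x).
Hypothesis FSl : forall p q x, p != q -> F p (S p q x) = S p q (F q x).
Hypothesis FSr : forall p q x, p != q -> F q (S p q x) = S p q (F p x).
Hypothesis S_id : forall p q x, p != q -> F p x = x -> F q x = x -> S p q x = x.
Hypothesis dense_fixed : dense_in_norm (\bigcup_n fixed_from n).

(** The projection onto the vectors fixed by [F p]: the conditional expectation that averages out
    digit [p]. *)
Definition flip_mean (p : nat) (x : V) : V := 2^-1 *: (x + F p x).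

(** The mean of highest index acts first, so that a new factor drops out as soon as [x] itself does
    not depend on its digit. *)
Fixpoint even_mean (n : nat) (x : V) : V :=
  if n is n'.+1 then even_mean n' (flip_mean n'.*2 x) else x.

Definition spread_step (n : nat) : V -> V := S n n.*2.+1.

(* [spread n] moves digit [i < n] to position [2 i + 1]. *)
Fixpoint spread (n : nat) (x : V) : V :=
  if n is n'.+1 then spread n' (spread_step n' x) else x.

(** The exchanges of [spread n] in the opposite order, which undo it. *)
Fixpoint gather (n : nat) (x : V) : V :=
  if n is n'.+1 then spread_step n' (gather n' x) else x.

Let stepN n : n != n.*2.+1. Proof. by lia. Qed.

Lemma linear_flip_mean p : linear (flip_mean p).
Proof.
move=> a x y; rewrite /flip_mean linF scalerA mulrC -scalerA -scalerDr.
by congr (_ *: _); rewrite scalerDr addrACA.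
Qed.

Lemma flip_mean_le p x : `|flip_mean p x| <= `|x|.
Proof.
rewrite normrZ ger0_norm ?invr_ge0// ler_pdivrMl//.
by apply: le_trans (ler_normD _ _) _; rewrite normF mulrDl !mul1r.
Qed.

Lemma linear_even_mean n : linear (even_mean n).
Proof. by elim: n => //= n IH a x y; rewrite linear_flip_mean IH. Qed.

Lemma even_mean_le n x : `|even_mean n x| <= `|x|.
Proof.
by elim: n x => //= n IH x; exact: le_trans (IH _) (flip_mean_le _ _).
Qed.

Lemma linear_spread n : linear (spread n).
Proof. by elim: n => //= n IH a x y; rewrite /spread_step linS IH. Qed.

Lemma norm_spread n x : `|spread n x| = `|x|.
Proof. by elim: n x => //= n IH x; rewrite IH normS. Qed.

Lemma linear_gather n : linear (gather n).
Proof. by elim: n => //= n IH a x y; rewrite IH /spread_step linS. Qed.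

Lemma norm_gather n x : `|gather n x| = `|x|.
Proof. by elim: n => //= n IH; rewrite normS IH. Qed.

Lemma spreadK n x : gather n (spread n x) = x.
Proof.
by elim: n x => //= n IH x; rewrite IH /spread_step SK.
Qed.

Lemma flip_mean_fixed p x : F p x = x -> flip_mean p x = x.
Proof.
move=> Fx; rewrite /flip_mean Fx -{1 2}[x]scale1r -scalerDl scalerA.
by rewrite -[1 + 1]/2%:R mulVf ?scale1r// pnatr_eq0.
Qed.

Lemma F_flip_mean p q x : F p (flip_mean q x) = flip_mean q (F p x).
Proof.
have [L LE] := linear_of_prop (linF p).
by rewrite /flip_mean -LE linearZ linearD /= !LE FC.
Qed.

Lemma F_even_mean p n x : F p (even_mean n x) = even_mean n (F p x).
Proof. by elim: n x => //= n IH x; rewrite IH F_flip_mean. Qed.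

Lemma flip_meanF p x : flip_mean p (F p x) = flip_mean p x.
Proof. by rewrite /flip_mean FK addrC. Qed.

Lemma even_meanF k n x : (k < n)%N -> even_mean n (F k.*2 x) = even_mean n x.
Proof.
elim: n x => //= n IH x; rewrite ltnS leq_eqVlt => /predU1P[->|kn].
  by rewrite flip_meanF.
by rewrite -F_flip_mean IH.
Qed.

Lemma even_mean_fixed n x :
  (forall k, (k < n)%N -> F k.*2 x = x) -> even_mean n x = x.
Proof.
elim: n => //= n IH Fx; rewrite flip_mean_fixed; last exact: Fx.
by apply: IH => k kn; apply: Fx; exact: ltnW.
Qed.

Lemma even_mean_stable m n x : fixed_from m x -> (m <= n)%N ->
  even_mean n x = even_mean m x.
Proof.
move=> Vx; elim: n => [|n IH]; first by rewrite leqn0 => /eqP->.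
rewrite leq_eqVlt => /predU1P[->//|mn] /=.
rewrite flip_mean_fixed; first exact: IH.
by apply: Vx; lia.
Qed.

Lemma F_even_mean_id k n x : (k < n)%N ->
  F k.*2 (even_mean n x) = even_mean n x.
Proof. by move=> kn; rewrite F_even_mean even_meanF. Qed.

Lemma spread_stable m n x : fixed_from m x -> (m <= n)%N ->
  spread n x = spread m x.
Proof.
move=> Vx; elim: n => [|n IH]; first by rewrite leqn0 => /eqP->.
rewrite leq_eqVlt => /predU1P[->//|mn] /=.
rewrite /spread_step S_id ?IH//; apply: Vx; lia.
Qed.

(** Call a position free if its flip fixes the vector. The hypothesis is the invariant of the
    induction: from [n] on, the even positions and those up to [2 n] are free. The exchange of [n]
    and [2 n + 1] frees position [n]; at [n = 0] the invariant says that all even positions are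
    free. *)
Lemma F_spread n x k :
  (forall q, (n <= q)%N -> ~~ odd q || (q < n.*2.+1)%N -> F q x = x) ->
  F k.*2 (spread n x) = spread n x.
Proof.
elim: n x => [|n IH] x Fx /=; first by apply: Fx => //; lia.
apply: IH => q nq qP; rewrite /spread_step.
have [->|qn] := eqVneq q n; first by rewrite FSl// Fx//; lia.
have [qE|qn'] := eqVneq q n.*2.+1; first by lia.
by rewrite FS// Fx//; lia.
Qed.

(** The invariant of [F_spread] run backwards: the exchange of [n] and [2 n + 1] frees position
    [2 n + 1], because position [n] was free before it. The positions from [m] on remain free
    throughout. *)
Lemma F_gather m n x :
  fixed_from m x -> (forall k, F k.*2 x = x) ->
  forall q, (n <= q)%N -> [|| ~~ odd q, (q < n.*2.+1)%N | (m <= q)%N] ->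
  F q (gather n x) = gather n x.
Proof.
move=> Vx Ex; elim: n => [|n IH] q nq qP /=.
  have [/Vx//|mq] := leqP m q.
  by have -> : q = q./2.*2 by lia.
rewrite /spread_step.
have [->|qn] := eqVneq q n.*2.+1; first by rewrite FSr// IH//; lia.
by rewrite FS// ?IH//; lia.
Qed.

(** For [n >= m] both positions of the next exchange are free by [F_gather], so it acts
    trivially. *)
Lemma gather_stable m n x :
  fixed_from m x -> (forall k, F k.*2 x = x) -> (m <= n)%N ->
  gather n x = gather m x.
Proof.
move=> Vx Ex; elim: n => [|n IH]; first by rewrite leqn0 => /eqP->.
rewrite leq_eqVlt => /predU1P[->//|mn] /=.
by rewrite /spread_step S_id ?IH//; rewrite (F_gather Vx)//; lia.
Qed.

Lemma gather_mean_stable m n x : fixed_from m x -> (m <= n)%N ->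
  gather n (even_mean n x) = gather m (even_mean m x).
Proof.
move=> Vx mn; rewrite (even_mean_stable Vx mn) (@gather_stable m)//.
  by move=> p mp; rewrite F_even_mean Vx.
move=> k; have [km|mk] := ltnP k m; first exact: F_even_mean_id.
by rewrite F_even_mean Vx//; lia.
Qed.

(** Midpoints are the only convex combinations that [flip_mean] forms. *)
Definition midpoint_convex (C : set V) :=
  forall x y, C x -> C y -> C (2^-1 *: (x + y)).

(** [J] and [K] are the strong limits of [spread n] and of [gather n] after [even_mean n]. The
    clause on [C] serves to transfer pointwise bounds on functions to [J x] and [K x]. *)
Lemma spread_gather_limits : exists J K : {linear V -> V},
  [/\ forall x, `|J x| = `|x|, forall x, `|K x| <= `|x|, cancel J K,
      forall k x, K (F k.*2 x) = K x &
      forall C : set V, closed C -> midpoint_convex C ->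
        (forall p x, C x -> C (F p x)) ->
        (forall p q x, p != q -> C x -> C (S p q x)) ->
        forall x, C x -> C (J x) /\ C (K x)].
Proof.
have [J JP] : exists J : {linear V -> V}, forall x,
    spread n x @[n --> \oo] --> J x.
  apply: (strong_limit linear_spread _ dense_fixed).
    by move=> n x; rewrite norm_spread.
  by move=> s [m _ Vs]; exists m => n; exact: spread_stable.
have [K KP] : exists K : {linear V -> V}, forall x,
    gather n (even_mean n x) @[n --> \oo] --> K x.
  apply: (strong_limit _ _ dense_fixed).
  - by move=> n a x y; rewrite linear_even_mean linear_gather.
  - by move=> n x; rewrite norm_gather even_mean_le.
  - by move=> s [m _ Vs]; exists m => n; exact: gather_mean_stable.
have nJ x : `|J x| = `|x|.
  have /cvg_norm/cvg_lim <- // := JP x.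
  by under eq_fun do rewrite norm_spread; rewrite lim_cst.
have nK x : `|K x| <= `|x|.
  have /cvg_norm Kx := KP x.
  apply: (closed_cvg (fun r : R => r <= `|x|) _ _ _ Kx); first exact: closed_le.
  by near=> n; rewrite /= norm_gather even_mean_le.
exists J, K; split => //.
(* Both [K \o J] and the identity are contractions, so comparing them on vectors of finitely many
   digits is enough. *)
- pose KJ : {linear V -> V} := K \o J.
  apply: (@dense_eq _ _ KJ idfun _ _ _ dense_fixed) => //=.
    by move=> x; rewrite (le_trans (nK _))// nJ.
  move=> s [m _ Vs].
  have Js : J s = spread m s.
    have /cvg_lim <- // := JP s.
    apply: lim_near_cst => //; exists m => // n /=; exact: spread_stable.
  have /cvg_lim <- // := KP (J s).
  apply: lim_near_cst => //; exists m => // n /= mn.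
  (* All even positions of [spread n s] are free, so [even_mean n] leaves it alone and [gather n]
     undoes [spread n]. *)
  rewrite Js -(spread_stable Vs mn) even_mean_fixed ?spreadK// => k _.
  by apply: F_spread => q nq _; apply: Vs; exact: leq_trans nq.
- move=> k x.
  have /cvg_lim <- // := KP (F k.*2 x).
  apply/cvg_lim => //; apply: cvg_trans (KP x); apply: near_eq_cvg.
  by exists k.+1 => // n /= kn; rewrite even_meanF.
- move=> C cC mC FCC SCC x Cx; split.
    apply: (closed_cvg C cC _ _ (JP x)); apply: nearW => n.
    by elim: n x Cx => //= n IH x Cx; apply/IH/SCC.
  apply: (closed_cvg C cC _ _ (KP x)); apply: nearW => n.
  have : C (even_mean n x).
    elim: n x Cx => //= n IH x Cx; apply: IH; apply: mC => //.
    exact: FCC.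
  (* The number of exchanges is generalised separately from the number of averagings. *)
  elim: {1}n (even_mean n x) => //= i IH y Cy; apply: SCC => //.
  exact: IH.
Unshelve. all: by end_near. Qed.

End digit_operators.

(** * Binary digits *)
Section binary_digits.
Context {R : realType}.
Implicit Types (t : R) (p q : nat).

(** On [[0, 1)] this is [2 t] modulo 1, the shift of binary expansions. *)
Definition doubling t : R := if t < 2^-1 then 2 * t else 2 * t - 1.

(** Digit 0 is the leading one; dyadic points of [[0, 1)] get the expansion that ends in zeros. *)
Fixpoint digit p t : bool :=
  if p is p'.+1 then digit p' (doubling t) else 2^-1 <= t.

Definition digit_weight p : R := 2^-1 ^+ p.+1.

(** The identity outside [[0, 1)], in particular at the endpoint 1, so that it is an involution of
    the whole line. *)
Definition flip p t : R :=
  if 0 <= t < 1 then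
    if digit p t then t - digit_weight p else t + digit_weight p
  else t.

(** Exchanging two different digits amounts to flipping both. *)
Definition exchange p q t : R :=
  if digit p t == digit q t then t else flip p (flip q t).

Lemma doubling_itv t : 0 <= t < 1 -> 0 <= doubling t < 1.
Proof. by rewrite /doubling => /andP[t0 t1]; case: ltP => ?; apply/andP; split; lra. Qed.

Lemma digit_weightS p : digit_weight p.+1 = digit_weight p / 2.
Proof. by rewrite /digit_weight exprSr. Qed.

Lemma flip_itv p t : 0 <= t < 1 -> 0 <= flip p t < 1.
Proof.
elim: p t => [|p IH] t t01.
  rewrite /flip t01 /= /digit_weight expr1; case/andP: t01 => t0 t1.
  by case: (leP _ t) => ?; apply/andP; split; lra.
have := IH _ (doubling_itv t01); rewrite /flip (doubling_itv t01) t01 /=.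
rewrite digit_weightS; case/andP: t01 => t0 t1.
set w := digit_weight p; case: (digit p _); rewrite /doubling;
  by case: ltP => ? /andP[? ?]; apply/andP; split; lra.
Qed.

(** Since [flip p (doubling t)] stays in [[0, 1)], moving [t] by half the weight of digit [p] cannot
    leave the half of the interval that contains [t]. *)
Lemma doubling_flip p t : 0 <= t < 1 ->
  doubling (flip p.+1 t) = flip p (doubling t) /\
  (2^-1 <= flip p.+1 t) = (2^-1 <= t).
Proof.
move=> t01; have := flip_itv p (doubling_itv t01).
rewrite /flip (doubling_itv t01) t01 /= digit_weightS.
case/andP: t01 => t0 t1; set w := digit_weight p.
by case: (digit p _); rewrite /doubling; case: (ltP t) => ? /andP[? ?];
  case: ltP => ?; split => //; lra.
Qed.

Lemma digit_flip p q t : 0 <= t < 1 ->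
  digit q (flip p t) = digit q t (+) (p == q).
Proof.
elim: p q t => [|p IH] [|q] t t01 /=.
- rewrite /flip t01 /= /digit_weight expr1; case/andP: t01 => t0 t1.
  by case: (leP _ t) => ?; case: leP => ? //=; exfalso; lra.
- rewrite addbF /flip t01 /= /digit_weight expr1; congr (digit q _).
  rewrite /doubling; case/andP: t01 => t0 t1.
  by case: (leP _ t) => ?; case: ltP => ? //=; lra.
- by rewrite addbF (doubling_flip p t01).2.
- by rewrite (doubling_flip p t01).1 IH// doubling_itv.
Qed.

Lemma flip_out p t : (0 <= t < 1) = false -> flip p t = t.
Proof. by rewrite /flip => ->. Qed.

Lemma flip_in p t : 0 <= t < 1 ->
  flip p t = if digit p t then t - digit_weight p else t + digit_weight p.
Proof. by rewrite /flip => ->. Qed.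

Lemma flip_inE p t : (0 <= flip p t < 1) = (0 <= t < 1).
Proof.
have [t01|/negbTE t01] := boolP (0 <= t < 1); first exact: flip_itv.
by rewrite flip_out.
Qed.

Lemma flipK p t : flip p (flip p t) = t.
Proof.
have [t01|/negbTE t01] := boolP (0 <= t < 1); last by rewrite !flip_out.
rewrite (flip_in p (flip_itv p t01)) digit_flip// eqxx addbT flip_in//.
by case: (digit p t) => /=; rewrite ?addrK ?subrK.
Qed.

Lemma flipC p q t : flip p (flip q t) = flip q (flip p t).
Proof.
have [t01|/negbTE t01] := boolP (0 <= t < 1); last by rewrite !flip_out.
have [->//|pq] := eqVneq p q.
rewrite (flip_in p (flip_itv q t01)) (flip_in q (flip_itv p t01)).
rewrite !digit_flip// (flip_in p t01) (flip_in q t01).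
rewrite (negbTE pq) eq_sym (negbTE pq) !addbF.
by case: (digit p t); case: (digit q t) => /=; rewrite addrAC.
Qed.

Lemma exchangeK p q t : exchange p q (exchange p q t) = t.
Proof.
have [t01|/negbTE t01] := boolP (0 <= t < 1); last first.
  by rewrite /exchange; case: ifP => _; rewrite ?flip_out//; case: ifP.
rewrite {2}/exchange; case: ifPn => [tE|tN]; first by rewrite /exchange tE.
have pq : p != q by apply: contraNneq tN => ->.
rewrite /exchange !digit_flip ?flip_itv// [q == p]eq_sym (negbTE pq).
rewrite (eqxx p) (eqxx q) !addbF !addbT (flipC q p) !flipK.
by move: tN; case: (digit p t); case: (digit q t).
Qed.

Lemma exchange_flip p q r t : p != q -> r != p -> r != q ->
  exchange p q (flip r t) = flip r (exchange p q t).
Proof.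
move=> pq rp rq; have [t01|/negbTE t01] := boolP (0 <= t < 1); last first.
  by rewrite /exchange !flip_out//; case: ifP.
rewrite /exchange !digit_flip// (negbTE rp) (negbTE rq) !addbF.
by case: ifP => // _; rewrite (flipC q) (flipC p).
Qed.

Lemma exchange_flipl p q t : p != q -> exchange p q (flip p t) = flip q (exchange p q t).
Proof.
move=> pq; have [t01|/negbTE t01] := boolP (0 <= t < 1); last first.
  by rewrite /exchange !flip_out//; case: ifP.
rewrite /exchange !digit_flip// eqxx (negbTE pq) addbF.
by case: (digit p t); case: (digit q t) => /=; rewrite (flipC q p) flipK.
Qed.

Lemma exchange_flipr p q t : p != q -> exchange p q (flip q t) = flip p (exchange p q t).
Proof.
move=> pq; have [t01|/negbTE t01] := boolP (0 <= t < 1); last first.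
  by rewrite /exchange !flip_out//; case: ifP.
rewrite /exchange !digit_flip// eqxx [q == p]eq_sym (negbTE pq) addbF.
by case: (digit p t); case: (digit q t) => /=; rewrite flipK.
Qed.

Lemma measurable_doubling : measurable_fun [set: R] doubling.
Proof.
apply: measurable_fun_ifT.
- by apply: measurable_fun_ltr => //; exact: measurable_cst.
- by apply: measurable_funM => //; exact: measurable_cst.
- apply: measurable_funB; last exact: measurable_cst.
  by apply: measurable_funM => //; exact: measurable_cst.
Qed.

Lemma measurable_digit p : measurable_fun [set: R] (digit p).
Proof.
elim: p => [|p IH] /=.
  by apply: measurable_fun_ler => //; exact: measurable_cst.
exact: (measurableT_comp IH measurable_doubling).
Qed.

Lemma measurable_flip p : measurable_fun [set: R] (flip p).
Proof.
apply: measurable_fun_ifT => //.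
- apply: measurable_and.
    by apply: measurable_fun_ler => //; exact: measurable_cst.
  by apply: measurable_fun_ltr => //; exact: measurable_cst.
- apply: measurable_fun_ifT => //; first exact: measurable_digit.
    by apply: measurable_funB => //; exact: measurable_cst.
  by apply: measurable_funD => //; exact: measurable_cst.
Qed.

Lemma measurable_exchange p q : measurable_fun [set: R] (exchange p q).
Proof.
apply: measurable_fun_ifT => //.
  have -> : (fun t : R => digit p t == digit q t) =
      (fun t => (digit p t && digit q t) || (~~ digit p t && ~~ digit q t)).
    by apply/funext => t; case: (digit p t); case: (digit q t).
  have mp := measurable_digit p; have mq := measurable_digit q.
  apply: measurable_or; apply: measurable_and => //; exact: measurable_neg.
exact: (measurableT_comp (measurable_flip p) (measurable_flip q)).
Qed.

Definition truncation m t : R := \sum_(p < m) (digit p t)%:R * digit_weight p.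

Lemma truncation_le m t : 0 <= t < 1 ->
  truncation m t <= t < truncation m t + 2^-1 ^+ m.
Proof.
rewrite /truncation; elim: m t => [|m IH] t t01.
  by rewrite big_ord0 add0r expr0.
have := IH _ (doubling_itv t01); rewrite big_ord_recl/= exprSr.
(* The digits of [t] after the first are those of [doubling t], with half the weight. *)
have -> : \sum_(i < m) (digit (bump 0 i) t)%:R * digit_weight (bump 0 i) =
    (\sum_(p < m) (digit p (doubling t))%:R * digit_weight p) / 2.
  rewrite big_distrl/=; apply: eq_bigr => i _.
  by rewrite /bump add1n digit_weightS mulrA.
set x := \sum_(_ < _) _; set e := 2^-1 ^+ m.
rewrite /digit_weight expr1 /doubling.
by case: ltP => ? /andP[? ?]; rewrite ?mul0r ?mul1r; apply/andP; split; lra.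
Qed.

Lemma truncation_flip m p t : (m <= p)%N ->
  truncation m (flip p t) = truncation m t.
Proof.
move=> mp; have [t01|/negbTE t01] := boolP (0 <= t < 1); last by rewrite flip_out.
apply: eq_bigr => i _; rewrite digit_flip//.
have -> : (p == i) = false by apply/eqP => pi; have := ltn_ord i; lia.
by rewrite addbF.
Qed.

Lemma measurable_truncation m : measurable_fun [set: R] (truncation m).
Proof.
rewrite /truncation; apply: measurable_sum => i.
apply: measurable_funM; last exact: measurable_cst.
have -> : (fun t : R => (digit i t)%:R : R) = (fun t => if digit i t then 1 else 0).
  by apply/funext => t; case: digit.
apply: measurable_fun_ifT; [exact: measurable_digit|exact: measurable_cst..].
Qed.

End binary_digits.

(** * Measure-preserving digit maps *)
Section measure_preserving.
Context {R : realType}.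
Notation mu := (@lebesgue_measure R).
Notation I01 := (@unit_itv R).

Lemma measurable_unit_itv : measurable I01.
Proof. exact: measurable_itv. Qed.

Lemma measurable_shift (c : R) (A : set R) : measurable A ->
  measurable [set t | A (t + c)].
Proof.
move=> mA; have mf : measurable_fun [set: R] (fun t => t + c).
  by apply: measurable_funD => //; exact: measurable_cst.
by rewrite -[X in measurable X]setTI; exact: mf.
Qed.

(** The pushforward under the shift agrees with Lebesgue measure on the intervals []a, b]], which
    determine it. *)
Lemma lebesgue_measure_shift (c : R) (A : set R) : measurable A ->
  mu [set t | A (t + c)] = mu A.
Proof.
move=> mA.
have mf : measurable_fun [set: measurableTypeR R]
    ((fun t => t + c) : measurableTypeR R -> measurableTypeR R).
  by apply: measurable_funD => //; exact: measurable_cst.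
pose f : {mfun measurableTypeR R >-> measurableTypeR R} :=
  HB.pack ((fun t => t + c) : measurableTypeR R -> measurableTypeR R)
    (isMeasurableFun.Build _ _ _ _ _ mf).
apply/esym/(@lebesgue_measure_unique _ (pushforward mu f)) => //.
move=> _ [[a b]] _ <-; rewrite /pushforward.
have fE : f @^-1` `]a, b] = `](a - c), (b - c)]%classic :> set R.
  by apply/seteqP; split=> t /=; rewrite !in_itv/= => /andP[? ?];
    apply/andP; split; lra.
transitivity (mu `](a - c), (b - c)]); last by rewrite -fE.
rewrite !lebesgue_measure_itv/= !lte_fin ltrD2r.
by case: ifP => // _; rewrite -!EFinB; congr EFin; lra.
Qed.

(** Applying the inequality to the preimage of [A], whose own preimage is [A], gives the reverse
    inequality. *)
Lemma mp_involution (tau : R -> R) :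
  involutive tau -> (forall t, I01 t -> I01 (tau t)) ->
  measurable_fun [set: R] tau ->
  (forall A : set R, measurable A -> A `<=` I01 ->
    (mu (I01 `&` tau @^-1` A) <= mu A)%E) ->
  mp_automorphism tau.
Proof.
move=> tauK tauI mtau le_mu.
have mpre (A : set R) : measurable A -> measurable (tau @^-1` A).
  by move=> mA; rewrite -[X in measurable X]setTI; exact: mtau.
split.
- split; first by move=> t /tauI.
    by move=> x y _ _ /(congr1 tau); rewrite !tauK.
  by move=> t It /=; exists (tau t); rewrite ?tauK//; exact: tauI.
- exact: measurable_funS mtau.
- move=> A mA _; suff -> : tau @` A = tau @^-1` A by exact: mpre.
  apply/seteqP; split=> [_ [t At <-]|t At] /=; first by rewrite tauK.
  by exists (tau t); rewrite ?tauK.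
- move=> A mA AI; apply/eqP; rewrite eq_le le_mu//=.
  have AE : I01 `&` tau @^-1` (I01 `&` tau @^-1` A) = A.
    apply/seteqP; split=> [t [_ [_]]|t At] /=; first by rewrite tauK.
    by rewrite tauK; split; [exact: AI|split => //; exact/tauI/AI].
  have mIA : measurable (I01 `&` tau @^-1` A).
    by apply: measurableI; [exact: measurable_unit_itv|exact: mpre].
  by rewrite -[in leLHS]AE le_mu// => t [].
Qed.

Lemma measurable_digit_set p : measurable [set t : R | digit p t].
Proof. by rewrite -[X in measurable X]setTI; exact: measurable_digit. Qed.

Lemma unit_itvE (t : R) : I01 t <-> 0 <= t <= 1.
Proof. by rewrite /unit_itv /= in_itv. Qed.

Lemma flip_unit_itv p (t : R) : I01 t -> I01 (flip p t).
Proof.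
have [/(flip_itv p) /andP[? /ltW ?] _|/negbTE t01] := boolP (0 <= t < 1).
  by apply/unit_itvE; apply/andP.
by rewrite flip_out.
Qed.

Lemma exchange_unit_itv p q (t : R) : I01 t -> I01 (exchange p q t).
Proof.
by move=> It; rewrite /exchange; case: ifP => // _; do 2 apply: flip_unit_itv.
Qed.

(** Split [A] into its points in [[0, 1)] with digit [p] equal to 1, those with digit 0, and the
    points outside [[0, 1)]. The preimage lies in the union of a translate of the first part, a
    translate of the second, and the third. *)
Lemma mp_flip p : mp_automorphism (@flip R p).
Proof.
apply: mp_involution; first exact: flipK.
- exact: flip_unit_itv.
- exact: measurable_flip.
move=> A mA AI.
have mD := measurable_digit_set p.
pose B : set R := `[0, 1[%classic.
have mB : measurable B by exact: measurable_itv.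
have BE t : B t <-> 0 <= t < 1 by rewrite /B /= in_itv.
set D := [set t : R | digit p t] in mD.
pose A1 := A `&` B `&` D; pose A0 := (A `&` B) `\` D; pose A2 := A `\` B.
have mA1 : measurable A1 by do 2 apply: measurableI => //.
have mA0 : measurable A0 by apply: measurableD => //; exact: measurableI.
have mA2 : measurable A2 by apply: measurableD.
pose w : R := digit_weight p.
have sub : I01 `&` flip p @^-1` A `<=`
    [set t | A1 (t + w)] `|` [set t | A0 (t + - w)] `|` A2.
  move=> t [It At] /=.
  have [t01|/negbTE t01] := boolP (0 <= t < 1); last first.
    by right; move: At; rewrite /= flip_out// => At; split=> // /BE; rewrite t01.
  left; have : B (flip p t) by apply/BE; exact: flip_itv.
  have : digit p (flip p t) = ~~ digit p t by rewrite digit_flip// eqxx addbT.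
  move: At; rewrite /= flip_in//; case: (digit p t) => /= At Dt Bt.
    by right; split=> //; rewrite /D /= Dt.
  by left; split.
have muA : (mu A = mu A1 + mu A0 + mu A2)%E.
  have -> : A = (A1 `|` A0) `|` A2 :> set R.
    by rewrite /A1 /A0 /A2 !setUIDK.
  rewrite measureU//; last 2 first.
    - exact: measurableU.
    - by apply/seteqP; split=> // t [[[[_ Bt] _]|[[_ Bt] _]] [_ nBt]].
  rewrite measureU//.
  by apply/seteqP; split=> // t [[_ Dt] [_ nDt]].
rewrite muA -(lebesgue_measure_shift w mA1) -(lebesgue_measure_shift (- w) mA0).
have m1 : measurable [set t | A1 (t + w)] by exact: measurable_shift.
have m0 : measurable [set t | A0 (t + - w)] by exact: measurable_shift.
apply: (@le_trans _ _ (mu ([set t | A1 (t + w)] `|` [set t | A0 (t + - w)] `|` A2))).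
  apply: (@le_measure _ _ _ mu); rewrite ?inE//.
  - apply: measurableI; first exact: measurable_unit_itv.
    by rewrite -[X in measurable X]setTI; exact: measurable_flip.
  - by apply: measurableU => //; exact: measurableU.
apply: (le_trans (measureU2 _ _ _)) => //; first exact: measurableU.
by rewrite leeD2r// measureU2.
Qed.

(** The map is the identity where the two digits agree; elsewhere it is a composite of two flips,
    which preserves the set where the digits differ. *)
Lemma mp_exchange p q : mp_automorphism (@exchange R p q).
Proof.
apply: mp_involution; first by move=> t; exact: exchangeK.
- by move=> t; exact: exchange_unit_itv.
- exact: measurable_exchange.
move=> A mA AI.
pose D : set R := [set t | digit p t == digit q t].
have mD : measurable D.
  have -> : D = ([set t | digit p t] `&` [set t | digit q t]) `|`
      (~` [set t | digit p t] `&` ~` [set t | digit q t]).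
    apply/seteqP; split=> t; rewrite /D /=.
      by case: (digit p t); case: (digit q t) => // _; [left|right].
    by case=> -[]; case: (digit p t); case: (digit q t).
  have := @measurable_digit_set p; have := @measurable_digit_set q => mq mp.
  by apply: measurableU; apply: measurableI => //; exact: measurableC.
have mpre r (C : set R) : measurable C -> measurable (I01 `&` flip r @^-1` C).
  move=> mC; apply: measurableI; first exact: measurable_unit_itv.
  by rewrite -[X in measurable X]setTI; exact: measurable_flip.
have muD : (mu A = mu (A `&` D) + mu (A `\` D))%E.
  rewrite -measureU; [by rewrite setUIDK|exact: measurableI|exact: measurableD|].
  by apply/seteqP; split=> // t [[_ ?] [_ ?]].
have mAD : measurable (A `\` D) by exact: measurableD.
have [_ _ _ muq] := mp_flip q; have [_ _ _ mup] := mp_flip p.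
rewrite muD -(mup (A `\` D)) //; last by move=> t [/AI].
rewrite -(muq (I01 `&` flip p @^-1` (A `\` D))); last 2 first.
- exact: mpre.
- by move=> t [].
apply: (@le_trans _ _ (mu ((A `&` D) `|`
    (I01 `&` flip q @^-1` (I01 `&` flip p @^-1` (A `\` D)))))).
  apply: (@le_measure _ _ _ mu); rewrite ?inE//.
  - apply: measurableI; first exact: measurable_unit_itv.
    by rewrite -[X in measurable X]setTI; exact: measurable_exchange.
  - by apply: measurableU; [exact: measurableI|exact: (mpre _ _ (mpre _ _ mAD))].
  move=> t [It] /=; rewrite /exchange; case: ifPn => [tE At|tN At]; first by left.
  right; split=> //; split; first exact: flip_unit_itv.
  have pq : p != q by apply: contraNneq tN => ->.
  split=> // ; apply/negP; move: tN.
  have [t01|/negbTE t01] := boolP (0 <= t < 1); last by rewrite !flip_out.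
  rewrite !digit_flip ?flip_itv// (eqxx p) (eqxx q) [q == p]eq_sym (negbTE pq).
  by case: (digit p t); case: (digit q t).
apply: measureU2; [exact: measurableI|exact: (mpre _ _ (mpre _ _ mAD))].
Qed.

End measure_preserving.

(** * Properties holding almost everywhere on the unit interval *)

Section almost_everywhere_unit_itv.
Context {R : realType}.
Notation mu := (@lebesgue_measure R).
Notation I01 := (@unit_itv R).
Implicit Types P Q S : R -> Prop.

Definition ae01 P : Prop := {ae mu, forall t, I01 t -> P t}.

Lemma ae01W P : (forall t, I01 t -> P t) -> ae01 P.
Proof. by move=> H; exact: aeW. Qed.

Lemma ae01S P Q : (forall t, I01 t -> P t -> Q t) -> ae01 P -> ae01 Q.
Proof.
move=> PQ; apply: (@filterS _ _ (ae_filter_ringOfSetsType mu)) => t Pt It.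
exact: PQ It (Pt It).
Qed.

Lemma ae01S2 P Q S :
  (forall t, I01 t -> P t -> Q t -> S t) -> ae01 P -> ae01 Q -> ae01 S.
Proof.
move=> PQS; apply: (@filterS2 _ _ (ae_filter_ringOfSetsType mu)) => t Pt Qt It.
exact: PQS It (Pt It) (Qt It).
Qed.

Lemma ae01S3 P Q S (U : R -> Prop) :
  (forall t, I01 t -> P t -> Q t -> S t -> U t) ->
  ae01 P -> ae01 Q -> ae01 S -> ae01 U.
Proof.
move=> PQSU aP aQ; apply: (@ae01S2 (fun t => P t /\ Q t)).
  by move=> t It [Pt Qt]; exact: PQSU.
exact: ae01S2 aP aQ.
Qed.

Lemma ae01_forall (P : nat -> R -> Prop) :
  (forall n, ae01 (P n)) -> ae01 (fun t => forall n, P n t).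
Proof.
move=> /ae_foralln.
by apply: (@filterS _ _ (ae_filter_ringOfSetsType mu)) => t + It n; apply.
Qed.

Lemma ae01_comp (tau : R -> R) P : mp_automorphism tau ->
  ae01 P -> ae01 (fun t => P (tau t)).
Proof.
move=> [[tauI _ _] mtau _ mutau] [N [mN muN subN]].
(* Preservation of measure speaks of subsets of [[0, 1]] only, so the null set is first cut down to
   it. *)
have mNI : measurable (N `&` I01).
  by apply: measurableI => //; exact: measurable_unit_itv.
exists (I01 `&` tau @^-1` (N `&` I01)); split.
- by apply: mtau => //; exact: measurable_unit_itv.
- have -> : mu (I01 `&` tau @^-1` (N `&` I01)) = mu (N `&` I01).
    by apply: mutau => // t [].
  by apply: (subset_measure0 mNI mN _ muN) => t [].
- move=> t /= /not_implyP[It nP]; split=> //; split; last exact: tauI.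
  by apply: subN => /= H; apply/nP/H; exact: tauI.
Qed.

End almost_everywhere_unit_itv.

(** * Köthe spaces *)
Section kothe.
Context {R : realType} {E : completeNormedModType R}.
Variable fn : E -> R -> R.
Hypothesis kE : kothe_space fn.
Notation mu := (@lebesgue_measure R).
Notation I01 := (@unit_itv R).

Implicit Types (f g : R -> R) (x y : E).

(** A choice, unique by [kothe_inj] whenever some element represents [f]. *)
Definition element_of (f : R -> R) : E := xget 0 [set y | represents fn y f].

Lemma element_ofP f : belongs fn f -> represents fn (element_of f) f.
Proof. by case=> x xf; rewrite /element_of; case: xgetP => [y _ //|/(_ x)]. Qed.

Lemma measurable_fn x : measurable_fun I01 (fn x).
Proof. by apply/measurable_EFinP; have /integrableP[] := kothe_integrable kE x. Qed.

Lemma represents_fn x : represents fn x (fn x).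
Proof. by split; [exact: measurable_fn|exact: ae_eq_refl]. Qed.

Lemma represents_unique x y f : represents fn x f -> represents fn y f -> x = y.
Proof.
move=> [_ xf] [_ yf]; apply: kothe_inj kE _ _ _.
exact: ae_eq_trans xf (ae_eq_sym yf).
Qed.

Lemma represents_ae x f g : represents fn x f -> measurable_fun I01 g ->
  ae_eq mu I01 f g -> represents fn x g.
Proof. by move=> [_ xf] mg fg; split => //; exact: ae_eq_trans xf fg. Qed.

Lemma represents_lin a x y f g : represents fn x f -> represents fn y g ->
  represents fn (a *: x + y) (fun t => a * f t + g t).
Proof.
move=> [mf xf] [mg yg]; split.
  by apply: measurable_funD => //; apply: measurable_funM => //; exact: measurable_cst.
by apply: ae01S3 (kothe_linear kE a x y) xf yg => t _ -> -> ->.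
Qed.

(** Linearity gives access to [fn 0]: write [0] as [-1 *: 0 + 0]. *)
Lemma represents0 : represents fn 0 (cst 0).
Proof.
have := represents_lin (-1) (represents_fn 0) (represents_fn 0).
rewrite scaler0 addr0 => H; apply: (represents_ae H).
  exact: measurable_cst.
by apply: ae01W => t _ /=; rewrite mulN1r addNr.
Qed.

Lemma representsD x y f g : represents fn x f -> represents fn y g ->
  represents fn (x + y) (fun t => f t + g t).
Proof.
move=> xf yg; have := represents_lin 1 xf yg; rewrite scale1r => H.
apply: (represents_ae H); last by apply: ae01W => t _; rewrite mul1r.
by case: xf => mf _; case: yg => mg _; exact: measurable_funD.
Qed.

Lemma representsZ a x f : represents fn x f ->
  represents fn (a *: x) (fun t => a * f t).
Proof.
move=> xf; have := represents_lin a xf represents0; rewrite addr0 => H.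
apply: (represents_ae H); last by apply: ae01W => t _; rewrite addr0.
by case: xf => mf _; apply: measurable_funM => //; exact: measurable_cst.
Qed.

Lemma representsB x y f g : represents fn x f -> represents fn y g ->
  represents fn (x - y) (fun t => f t - g t).
Proof.
move=> xf yg; have := representsD xf (representsZ (-1) yg).
rewrite scaleN1r => H; apply: (represents_ae H).
  by case: xf => mf _; case: yg => mg _; exact: measurable_funB.
by apply: ae01W => t _; rewrite mulN1r.
Qed.

Lemma represents_sum (I : Type) (r : seq I) (x : I -> E) (f : I -> R -> R) :
  (forall i, represents fn (x i) (f i)) ->
  represents fn (\sum_(i <- r) x i) (fun t => \sum_(i <- r) f i t).
Proof.
move=> xf; elim: r => [|i r IH].
  rewrite big_nil; apply: (represents_ae represents0); last first.
    by apply: ae01W => t _; rewrite big_nil.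
  by under eq_fun do rewrite big_nil; exact: measurable_cst.
rewrite big_cons (_ : (fun t => _) = (fun t => f i t + \sum_(j <- r) f j t)).
  exact: representsD.
by apply/funext => t; rewrite big_cons.
Qed.

(** Solidity provides some element with the wanted bound; injectivity of [fn] identifies it with
    [x]. *)
Lemma represents_le x y f g : represents fn x f -> represents fn y g ->
  ae01 (fun t => `|f t| <= `|g t|) -> `|x| <= `|y|.
Proof.
move=> xf [mg yg] fg; have mf := xf.1.
have [|z zf zy] := kothe_solid kE (y := y) mf.
  by apply: ae01S2 fg yg => t _ + ->.
by rewrite (represents_unique xf zf).
Qed.

Lemma belongs_le y f g : represents fn y g -> measurable_fun I01 f ->
  ae01 (fun t => `|f t| <= `|g t|) -> belongs fn f.
Proof.
move=> [mg yg] mf fg.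
have [|z zf _] := kothe_solid kE (y := y) mf; last by exists z.
by apply: ae01S2 fg yg => t _ + ->.
Qed.

Lemma belongs_indic (A : set R) : measurable A -> belongs fn \1_A.
Proof.
move=> mA; have [|||x x1] := kothe_indic kE (A := I01).
- exact: measurable_unit_itv.
- by [].
- by rewrite lebesgue_measure_itv/= lte_fin ltr01 ltry.
apply: (belongs_le x1); first exact: measurable_indic.
apply: ae01W => t It; rewrite !indicE (mem_set It) normr1.
by case: (t \in A); rewrite ?normr1 ?normr0.
Qed.

Definition indicator (A : set R) : E := element_of \1_A.

Lemma indicatorP A : measurable A -> represents fn (indicator A) \1_A.
Proof. by move=> mA; apply/element_ofP/belongs_indic. Qed.

(** The trace on [E] of the ball of radius [c] for the essential supremum norm. *)
Definition sup_ball (c : R) : set E := [set x | ae01 (fun t => `|fn x t| <= c)].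

Lemma sup_ballP c x f : represents fn x f ->
  ae01 (fun t => `|f t| <= c) -> sup_ball c x.
Proof.
by move=> [_ xf]; apply: ae01S2 xf => t _ ->.
Qed.

Lemma midpoint_convex_sup_ball c : midpoint_convex (sup_ball c).
Proof.
move=> x y xc yc; apply: (sup_ballP (representsZ _ (representsD
  (represents_fn x) (represents_fn y)))).
apply: ae01S2 xc yc => t _ X Y.
rewrite normrM ger0_norm ?invr_ge0// ler_pdivrMl//.
by apply: le_trans (ler_normD _ _) _; lra.
Qed.

(* The excess [(|x| - c)^+] is 1-Lipschitz in [x] and vanishes on the ball. *)
Lemma closed_sup_ball c : 0 <= c -> closed (sup_ball c).
Proof.
move=> c0 x clx.
pose f t := Num.max (`|fn x t| - c) 0.
have mf : measurable_fun I01 f.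
  apply: measurable_maxr; last exact: measurable_cst.
  apply: measurable_funB; last exact: measurable_cst.
  by apply: measurableT_comp; [exact: normr_measurable|exact: measurable_fn].
have f_le (r : R) : `|Num.max (`|r| - c) 0| <= `|r|.
  rewrite ger0_norm ?le_max ?lexx ?orbT// ge_max normr_ge0 andbT.
  by rewrite lerBlDr lerDl.
have /element_ofP yf : belongs fn f.
  by apply: (belongs_le (represents_fn x) mf); apply: ae01W => t _; exact: f_le.
have y0 : element_of f = 0.
  apply/eqP; rewrite -normr_le0; apply/ler_addgt0Pr => e e0; rewrite add0r.
  have [z [zc]] := clx _ (nbhsx_ballx x e e0).
  rewrite -ball_normE /ball_/= => /ltW xz; apply: le_trans xz.
  apply: (represents_le yf (representsB (represents_fn x) (represents_fn z))).
  apply: ae01S zc => t _ Z; rewrite /f ger0_norm ?le_max ?lexx ?orbT//.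
  rewrite ge_max normr_ge0 andbT.
  have := ler_normD (fn x t - fn z t) (fn z t); rewrite subrK; lra.
have [_ yf'] := yf; have [_ y0'] := represents0.
rewrite y0 in yf'; apply: ae01S2 yf' y0' => t _ Y Z.
have : f t = 0 by rewrite -Y Z.
by rewrite /f; case: (leP (`|fn x t| - c) 0) => H ?; lra.
Qed.

End kothe.

(** * Composition with measure-preserving automorphisms *)

Section composition_operators.
Context {R : realType} {E : completeNormedModType R}.
Variable fn : E -> R -> R.
Hypothesis riE : ri_space fn.
Notation mu := (@lebesgue_measure R).
Notation I01 := (@unit_itv R).
Implicit Types (f g : R -> R) (x y : E) (tau : R -> R).
Let kE := ri_kothe riE.

Definition composition tau x : E := element_of fn (fn x \o tau).

Lemma composition_represents tau x f : mp_automorphism tau ->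
  represents fn x f -> represents fn (composition tau x) (f \o tau).
Proof.
move=> mtau [mf xf].
have [[bfn _] _] := ri_invariant riE mtau (measurable_fn kE x).
have /bfn/element_ofP cx : belongs fn (fn x) by exists x; exact: represents_fn.
apply: (represents_ae cx); last exact: (ae01_comp mtau xf).
have [[tauI _ _] mtau' _ _] := mtau.
apply: (measurable_comp (measurable_unit_itv (R := R))) => // _ [t It <-].
exact: tauI.
Qed.

Lemma linear_composition tau : mp_automorphism tau -> linear (composition tau).
Proof.
move=> mtau a x y.
apply: (represents_unique kE (composition_represents mtau (represents_lin kE a
  (represents_fn kE x) (represents_fn kE y)))).
by apply: (represents_lin kE); exact: (composition_represents mtau (represents_fn kE _)).
Qed.

Lemma norm_composition tau x : mp_automorphism tau -> `|composition tau x| = `|x|.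
Proof.
move=> mtau; have [_ H] := ri_invariant riE mtau (measurable_fn kE x).
have xf := represents_fn kE x.
by rewrite -(H _ _ xf (composition_represents mtau xf)).
Qed.

Lemma composition_comp tau sigma x : mp_automorphism tau -> mp_automorphism sigma ->
  represents fn (composition tau (composition sigma x)) (fun t => fn x (sigma (tau t))).
Proof.
move=> mtau msigma.
exact: (composition_represents mtau
  (composition_represents msigma (represents_fn kE x))).
Qed.

Lemma composition_comm tau sigma tau' sigma' x :
  mp_automorphism tau -> mp_automorphism sigma ->
  mp_automorphism tau' -> mp_automorphism sigma' ->
  (forall t, sigma (tau t) = sigma' (tau' t)) ->
  composition tau (composition sigma x) = composition tau' (composition sigma' x).
Proof.
move=> m1 m2 m3 m4 e; apply: (represents_unique kE (composition_comp _ m1 m2)).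
by under eq_fun do rewrite e; exact: composition_comp.
Qed.

Lemma composition_involutive tau x : mp_automorphism tau -> involutive tau ->
  composition tau (composition tau x) = x.
Proof.
move=> mtau tauK; apply: (represents_unique kE (composition_comp _ mtau mtau)).
by under eq_fun do rewrite tauK; exact: represents_fn.
Qed.

Lemma composition_sup_ball tau c x : mp_automorphism tau ->
  sup_ball fn c x -> sup_ball fn c (composition tau x).
Proof.
move=> mtau xc.
apply: (sup_ballP (composition_represents mtau (represents_fn kE x))).
exact: (ae01_comp mtau xc).
Qed.

Definition flip_op (p : nat) : E -> E := composition (flip p).
Definition exchange_op (p q : nat) : E -> E := composition (exchange p q).

(** At each point [exchange p q] is either the identity or the double flip, and almost everywhere
    neither changes the value of [x]. *)
Lemma exchange_op_id p q x : flip_op p x = x -> flip_op q x = x ->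
  exchange_op p q x = x.
Proof.
move=> px qx; have mp := @mp_flip R p; have mq := @mp_flip R q.
have [_ xf] : represents fn x (fun t => fn x (flip p (flip q t))).
  by rewrite -{1}qx -{1}px; exact: composition_comp.
apply: (represents_unique kE _ (represents_fn kE x)).
apply: (represents_ae (composition_represents (mp_exchange p q) (represents_fn kE x))).
  exact: measurable_fn.
apply: ae01S xf => t _ /= H.
by rewrite /exchange; case: ifP => // _; rewrite -H.
Qed.

End composition_operators.

(** * Density of the functions of finitely many digits *)
Section density.
Context {R : realType} {E : completeNormedModType R}.
Variable fn : E -> R -> R.
Hypotheses (riE : ri_space fn) (ocE : order_continuous fn).
Notation mu := (@lebesgue_measure R).
Notation I01 := (@unit_itv R).
Implicit Types (f g : R -> R) (x y : E) (A B : set R).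
Let kE := ri_kothe riE.
Let ind := indicator fn.
Let indP A : measurable A -> represents fn (ind A) \1_A.
Proof. exact: indicatorP. Qed.

(** Order continuity read on chosen representatives: countably many null sets are discarded at
    once. *)
Lemma order_continuous_cvg0 (x : nat -> E) (f : nat -> R -> R) :
  (forall n, represents fn (x n) (f n)) ->
  ae01 (fun t => nonincreasing_seq (fun n => f n t) /\
                 (fun n => f n t) @ \oo --> (0 : R)) ->
  forall e : R, 0 < e -> exists n, `|x n| < e.
Proof.
move=> xf f0 e e0.
have [|_ /cvgrPdist_lt/(_ e e0)[n _ /(_ n (leqnn n))]] := ocE (x := x).
  apply: ae01S2 (ae01_forall (fun n => (xf n).2)) f0 => t _ H.
  by have -> : (fun n => fn (x n) t) = (fun n => f n t) by apply/funext.
by rewrite /= sub0r normrN normr_id => xn; exists n.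
Qed.

(** Outside [[0, 1)], where [flip] is the identity, the invariance is automatic. *)
Definition digit_set (m : nat) A : Prop :=
  measurable A /\ forall p t, (m <= p)%N -> A (flip p t) = A t.

(** Approximation is in the norm of [E]. These sets are shown to form a sigma-algebra that contains
    the rays, hence every Borel set. *)
Definition approx_digit_set A : Prop := measurable A /\
  forall e : R, 0 < e -> exists m B, digit_set m B /\ `|ind A - ind B| < e.

Lemma approx_of_digit_set m A : digit_set m A -> approx_digit_set A.
Proof.
move=> mA; split=> [|e e0]; first by case: mA.
by exists m, A; rewrite subrr normr0.
Qed.

Lemma approx_digit_setC A : approx_digit_set A -> approx_digit_set (~` A).
Proof.
move=> [mA apA]; split=> [|e e0]; first exact: measurableC.
have [m [B [[mB Bd] AB]]] := apA e e0.
exists m, (~` B); split.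
  by split; [exact: measurableC|move=> p t mp; rewrite /setC/= Bd].
apply: le_lt_trans AB.
have mAC := measurableC mA; have mBC := measurableC mB.
apply: (represents_le kE (representsB kE (indP mAC) (indP mBC))
  (representsB kE (indP mA) (indP mB))).
apply: ae01W => t _; rewrite !indicE !in_setC.
by case: (t \in A); case: (t \in B); rewrite /= ?subrr// distrC.
Qed.

Lemma approx_digit_setU A A' : approx_digit_set A -> approx_digit_set A' ->
  approx_digit_set (A `|` A').
Proof.
move=> [mA apA] [mA' apA']; have mU := measurableU _ _ mA mA'.
split=> // e e0; have e20 : 0 < e / 2 by rewrite divr_gt0.
have [m [B [[mB Bd] AB]]] := apA _ e20.
have [m' [B' [[mB' Bd'] AB']]] := apA' _ e20.
have mUB := measurableU _ _ mB mB'.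
exists (maxn m m'), (B `|` B'); split.
  split=> // p t; rewrite geq_max => /andP[mp m'p].
  by rewrite /setU/= Bd// Bd'.
apply: (@le_lt_trans _ _ (`|ind A - ind B| + `|ind A' - ind B'|)); last by lra.
(* The two indicators of unions differ by at most a sum of two absolute values, which must
   themselves be represented in [E]. *)
pose g A B t : R := `|\1_A t - \1_B t|.
have gE A1 B1 : measurable A1 -> measurable B1 -> exists2 y,
    represents fn y (g A1 B1) & `|y| <= `|ind A1 - ind B1|.
  move=> mA1 mB1; have AB1 := representsB kE (indP mA1) (indP mB1).
  have mg : measurable_fun I01 (g A1 B1).
    apply: measurableT_comp; first exact: normr_measurable.
    by apply: measurable_funB; exact: measurable_indic.
  have /element_ofP yg : belongs fn (g A1 B1).
    by apply: (belongs_le kE AB1) => //; apply: ae01W => t _; rewrite normr_id.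
  exists (element_of fn (g A1 B1)) => //.
  by apply: (represents_le kE yg AB1); apply: ae01W => t _; rewrite normr_id.
have [y yg yle] := gE A B mA mB; have [y' yg' yle'] := gE A' B' mA' mB'.
apply: le_trans (lerD yle yle'); apply: le_trans (ler_normD _ _).
apply: (represents_le kE (representsB kE (indP mU) (indP mUB))
  (representsD kE yg yg')).
apply: ae01W => t _; rewrite /g !indicE !in_setU.
by case: (t \in A); case: (t \in B); case: (t \in A'); case: (t \in B');
  rewrite /= ?(subrr, subr0, sub0r, normr0, normrN, normr1, add0r, addr0) ?ler01//
    ger0_norm// lerDl.
Qed.

(** The finite unions [U n] increase to the whole union, so by order continuity their indicators
    converge in norm; each [U n] is approximable by the finite case. *)
Lemma approx_digit_set_bigcup (A : nat -> set R) :
  (forall n, approx_digit_set (A n)) -> approx_digit_set (\bigcup_n A n).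
Proof.
move=> apA; have mA n : measurable (A n) by case: (apA n).
have mU : measurable (\bigcup_n A n) by exact: bigcupT_measurable.
pose U n := \bigcup_(i < n) A i.
have UE n : U n.+1 = U n `|` A n.
  rewrite /U; apply/seteqP; split=> [t [i /= ]|t [[i /= iltn At]|At]].
  - rewrite ltnS leq_eqVlt => /predU1P[->|iltn] At; first by right.
    by left; exists i.
  - by exists i => //=; exact: ltnW.
  - by exists n => /=.
have apU n : approx_digit_set (U n).
  elim: n => [|n IH]; last by rewrite UE; exact: approx_digit_setU.
  have -> : U 0 = set0 by apply/seteqP; split=> // t [].
  by apply: (@approx_of_digit_set 0); split.
have mUn n : measurable (U n) by case: (apU n).
split=> // e e0; have e20 : 0 < e / 2 by rewrite divr_gt0.
pose f n t : R := \1_(\bigcup_n A n) t - \1_(U n) t.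
have fE n : represents fn (ind (\bigcup_n A n) - ind (U n)) (f n).
  exact: (representsB kE (indP mU) (indP (mUn n))).
have [|n xn] := order_continuous_cvg0 fE _ e20.
  apply: ae01W => t _; rewrite /f; split.
    move=> i j ij; rewrite lerB// !indicE ler_nat.
    have [[k /= ki Ak]|nU] := pselect (U i t); last by rewrite memNset.
    by rewrite !mem_set//; exists k => //=; exact: leq_trans ki ij.
  have [[k _ Ak]|nA] := pselect ((\bigcup_n A n) t).
    apply: cvg_near_cst; exists k.+1 => // n /= kn.
    by rewrite !indicE !mem_set ?subrr//; exists k.
  apply: cvg_near_cst; exists 0 => // n _.
  rewrite !indicE !memNset ?subrr// => -[k _ Ak]; apply: nA; by exists k.
have [m [B [mB UB]]] := (apU n).2 _ e20.
exists m, B; split => //.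
rewrite -(subrK (ind (U n)) (ind (\bigcup_n A n))) -addrA.
by apply: le_lt_trans (ler_normD _ _) _; lra.
Qed.

(** Truncations approach [t] from below, so [t > a] on [[0, 1)] means that some truncation exceeds
    [a], a condition invariant under the flips of later digits. *)
Lemma approx_digit_set_ray (a : R) : approx_digit_set `]a, +oo[.
Proof.
pose I : set R := `[0, 1[%classic.
have IE t : I t = (0 <= t < 1) by rewrite /I /= in_itv.
have mI : measurable I by exact: measurable_itv.
pose B m := (I `&` [set t | a < truncation m t]) `|` (`]a, +oo[ `\` I).
have -> : `]a, +oo[%classic = \bigcup_m B m.
  apply/seteqP; split=> [t at_|t [m _ [[It /= atr]|[]//]]]; last first.
    move: It; rewrite IE => /(truncation_le m)/andP[trt _].
    by rewrite in_itv/= andbT; exact: lt_le_trans trt.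
  have [It|nIt] := pselect (I t); last by exists 0 => //; right.
  move: at_; rewrite /= in_itv/= andbT -subr_gt0 => at_.
  have /cvgrPdist_lt/(_ _ at_)[m _ /(_ m (leqnn m))] :
      (fun m => (2^-1 : R) ^+ m) @ \oo --> (0 : R).
    by apply: cvg_expr; rewrite ger0_norm ?invf_lt1 ?ltr1n ?invr_ge0.
  rewrite /= sub0r normrN ger0_norm ?exprn_ge0 ?invr_ge0// => tm.
  exists m => //; left; split=> //=.
  by move: It; rewrite IE => /(truncation_le m)/andP[]; lra.
apply: approx_digit_set_bigcup => m; apply: (@approx_of_digit_set m); split.
  apply: measurableU.
    apply: measurableI => //; rewrite -[X in measurable X]setTI.
    have -> : [set: R] `&` [set t | a < truncation m t] =
        [set: R] `&` truncation m @^-1` `]a, +oo[%classic.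
      by apply/seteqP; split=> t /=; rewrite in_itv/= andbT.
    exact: measurable_truncation.
  by apply: measurableD => //; exact: measurable_itv.
move=> p t mp; rewrite /B /setU /setI /setD /= !IE flip_inE truncation_flip//.
have [//|/negbTE t01] := boolP (0 <= t < 1); last by rewrite flip_out.
by move=> _; rewrite propeqE; split=> -[[_ ?]|[_ /(_ isT)//]]; left.
Qed.

Lemma approx_measurable A : measurable A -> approx_digit_set A.
Proof.
move=> mA; have : (@RGenOInfty.G R).-sigma.-measurable A.
  by rewrite -RGenOInfty.measurableE.
apply: smallest_sub; last by move=> _ [a ->]; exact: approx_digit_set_ray.
split.
- by apply: (@approx_of_digit_set 0); split.
- by move=> B apB; rewrite setTD; exact: approx_digit_setC.
- exact: approx_digit_set_bigcup.
Qed.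

Notation fixed := (\bigcup_n fixed_from (flip_op fn) n).

Definition near_fixed x := forall e : R, 0 < e -> exists2 s, fixed s & `|x - s| < e.

Lemma near_fixed_indicator A : measurable A -> near_fixed (ind A).
Proof.
move=> /approx_measurable[_ apA] e /apA[m [B [[mB Bd] AB]]].
exists (ind B) => //; exists m => // p mp.
apply: (represents_unique kE (composition_represents riE (mp_flip p) (indP mB))).
have -> : \1_B \o flip p = \1_B :> (R -> R); last exact: indP.
by apply/funext => t /=; rewrite !indicE /in_mem/= /in_set/= Bd.
Qed.

Lemma fixed_lin a x y : fixed x -> fixed y -> fixed (a *: x + y).
Proof.
move=> [m _ mx] [n _ ny]; exists (maxn m n) => // p; rewrite geq_max => /andP[mp np].
by rewrite /flip_op (linear_composition riE (mp_flip p)) [X in _ *: X]mx//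
  [X in _ + X]ny.
Qed.

Lemma near_fixed_lin a x y : near_fixed x -> near_fixed y -> near_fixed (a *: x + y).
Proof.
move=> nx ny e e0.
(* Adding 1 keeps the divisor positive when [a] is 0. *)
have a0 : 0 < `|a| + 1 by rewrite ltr_wpDl.
have [s fs xs] := nx (e / 2 / (`|a| + 1)) (divr_gt0 (divr_gt0 e0 (ltr0Sn _ _)) a0).
have [u fu yu] := ny (e / 2) (divr_gt0 e0 (ltr0Sn _ _)).
exists (a *: s + u); first exact: fixed_lin.
rewrite opprD addrACA -scalerBr; apply: le_lt_trans (ler_normD _ _) _.
rewrite normrZ; have : `|a| * `|x - s| <= e / 2.
  apply: (@le_trans _ _ ((`|a| + 1) * `|x - s|)).
    by rewrite ler_wpM2r// lerDl.
  by rewrite mulrC -ler_pdivlMr// ltW.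
lra.
Qed.

Lemma near_fixed0 : near_fixed 0.
Proof.
move=> e e0; exists 0; last by rewrite subrr normr0.
exists 0 => // p _; have := linear_composition riE (mp_flip p) (-1) 0 0.
by rewrite scaler0 addr0 scaleN1r addNr.
Qed.

Lemma near_fixed_limit x :
  (forall e : R, 0 < e -> exists2 y, near_fixed y & `|x - y| < e) ->
  near_fixed x.
Proof.
move=> nx e e0; have e20 : 0 < e / 2 by rewrite divr_gt0.
have [y ny xy] := nx _ e20; have [s fs ys] := ny _ e20.
exists s => //; rewrite -(subrK y x) -addrA.
by apply: le_lt_trans (ler_normD _ _) _; lra.
Qed.

Import HBNNSimple.

Lemma near_fixed_nnsfun (h : {nnsfun R >-> R}) x :
  represents fn x (h : R -> R) -> near_fixed x.
Proof.
move=> xh; pose r : seq R := finmap.enum_fset (fset_set (range h)).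
have : represents fn (\sum_(c <- r) c *: ind (h @^-1` [set c])) h.
  rewrite [X in represents _ _ X](_ : _ =
      fun t => \sum_(c <- r) (c * \1_(h @^-1` [set c]) t)); last first.
    by apply/funext => t; rewrite fimfunE fsbig_finite.
  apply: (represents_sum kE) => c; apply: (representsZ kE c (indP _)).
  exact: measurable_sfunP.
move/(represents_unique kE xh) => ->.
elim: (r : seq R) => [|c s IH]; first by rewrite big_nil; exact: near_fixed0.
rewrite big_cons; apply: near_fixed_lin => //; apply: near_fixed_indicator.
exact: measurable_sfunP.
Qed.

(** Simple functions increase to [f], so the differences decrease to 0 and order continuity turns
    this into norm convergence. *)
Lemma near_fixed_nonneg x f : represents fn x f -> (forall t, 0 <= f t) -> near_fixed x.
Proof.
move=> xf f0; apply: near_fixed_limit => e e0.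
have mf : measurable_fun I01 (EFin \o f) by apply/measurable_EFinP; case: xf.
have mI := measurable_unit_itv (R := R).
pose h := nnsfun_approx mI mf.
have nd_h t : nondecreasing_seq (fun n => h n t).
  move=> m n mn.
  by have /lefP := nd_nnsfun_approx mI mf mn; apply.
have cvg_h t : I01 t -> (fun n => h n t) @ \oo --> f t.
  move=> It; have := cvg_nnsfun_approx mI mf (fun t _ => f0 t) It.
  by move/fine_cvgP => [_].
have le_h n t : I01 t -> h n t <= f t.
  move=> It; rewrite -(cvg_lim _ (cvg_h t It))//.
  apply: (nondecreasing_cvgn_le (nd_h t)).
  by apply/cvg_ex; exists (f t); exact: cvg_h.
have mh n : measurable_fun I01 (h n) by exact: measurable_funTS.
have hP n : represents fn (element_of fn (h n)) (h n).
  apply: element_ofP; apply: (belongs_le kE xf) => //.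
  by apply: ae01W => t It; rewrite !ger0_norm ?le_h.
have [|n xn] := order_continuous_cvg0 (fun n => representsB kE xf (hP n)) _ e0.
  apply: ae01W => t It; split.
    by move=> i j ij; rewrite lerB// nd_h.
  by rewrite -(subrr (f t)); apply: cvgB; [exact: cvg_cst|exact: cvg_h].
by exists (element_of fn (h n)) => //; exact: near_fixed_nnsfun (hP n).
Qed.

(** Split [x] into its positive and negative parts, which belong to [E] by solidity. *)
Lemma dense_fixed_from : dense_in_norm fixed.
Proof.
move=> x; apply: (_ : near_fixed x).
have mx := measurable_fn kE x.
pose f t := Num.max (fn x t) 0; pose g t := Num.max (- fn x t) 0.
have mf : measurable_fun I01 f by apply: measurable_maxr => //; exact: measurable_cst.
have mg : measurable_fun I01 g.
  by apply: measurable_maxr; [exact: measurableT_comp|exact: measurable_cst].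
have f0 t : 0 <= f t by rewrite /f le_max lexx orbT.
have g0 t : 0 <= g t by rewrite /g le_max lexx orbT.
have /element_ofP yf : belongs fn f.
  apply: (belongs_le kE (represents_fn kE x) mf); apply: ae01W => t _.
  by rewrite (ger0_norm (f0 t)) /f ge_max ler_norm normr_ge0.
have /element_ofP zg : belongs fn g.
  apply: (belongs_le kE (represents_fn kE x) mg); apply: ae01W => t _.
  by rewrite (ger0_norm (g0 t)) /g ge_max -normrN ler_norm normr_ge0.
have -> : x = (-1) *: element_of fn g + element_of fn f.
  apply: (represents_unique kE (represents_fn kE x)).
  apply: (represents_ae (represents_lin kE (-1) zg yf)) => //.
  apply: ae01W => t _; rewrite /f /g mulN1r.
  by case: (leP (fn x t) 0) => ?; case: (leP (- fn x t) 0) => ?; lra.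
apply: near_fixed_lin; [exact: near_fixed_nonneg zg g0|exact: near_fixed_nonneg yf f0].
Qed.

End density.

(** * Narrowness *)
Section narrowness.
Context {R : realType}.
Notation mu := (@lebesgue_measure R).
Notation I01 := (@unit_itv R).
Implicit Types A B : set R.

Lemma lebesgue_measure_le A B : measurable A -> measurable B ->
  A `<=` B -> (mu A <= mu B)%E.
Proof. by move=> mA mB AB; apply: (@le_measure _ _ _ mu); rewrite ?inE. Qed.

Lemma lebesgue_measure_fin A : measurable A -> A `<=` I01 -> mu A \is a fin_num.
Proof.
move=> mA AI; rewrite ge0_fin_numE//; apply: (@le_lt_trans _ _ (mu I01)).
  by apply: lebesgue_measure_le => //; exact: measurable_unit_itv.
by rewrite lebesgue_measure_itv/= lte_fin ltr01 ltry.
Qed.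

(** The measure of the part of [A] up to [t] is a 1-Lipschitz function of [t], so the intermediate
    value theorem finds where it equals half of the total. *)
Lemma halving_set A : measurable A -> A `<=` I01 ->
  exists C : set R, [/\ measurable C, C `<=` A & mu C = mu (A `\` C)].
Proof.
move=> mA AI.
pose C (t : R) := A `&` `]-oo, t]%classic.
have mC t : measurable (C t) by exact: measurableI.
have CI t : C t `<=` I01 by move=> u [/AI].
have muA := lebesgue_measure_fin mA AI.
have muC t : mu (C t) \is a fin_num by exact: lebesgue_measure_fin.
pose G t := fine (mu (C t)).
have G_le s t : s <= t -> G s <= G t <= G s + (t - s).
  move=> st; apply/andP; split.
    rewrite fine_le// lebesgue_measure_le// => u [Au] /=.
    by rewrite !in_itv/= => us; split => //=; rewrite in_itv/= (le_trans us).
  rewrite -lee_fin EFinD !fineK//.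
  have -> : (t - s)%:E = mu `]s, t].
    rewrite lebesgue_measure_itv/= lte_fin -EFinD; case: ltP => // ts.
    by rewrite (@le_anti _ _ s t) ?subrr// st.
  apply: (@le_trans _ _ (mu (C s `|` `]s, t]%classic))); last first.
    by apply: measureU2; [exact: mC|exact: measurable_itv].
  apply: lebesgue_measure_le => //; first by apply: measurableU.
  move=> u [Au] /=; rewrite in_itv/= => ut.
  have [us|su] := leP u s; first by left; split=> //=; rewrite in_itv.
  by right; rewrite /= in_itv/= su ut.
have cG : continuous G.
  move=> s; apply/cvgrPdist_lt => e e0; exists e => // t.
  rewrite /ball_/= => st; apply: le_lt_trans st.
  have [/G_le|/ltW/G_le] := leP s t => /andP[? ?].
    by rewrite distrC ger0_norm ?subr_ge0// distrC ger0_norm; lra.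
  by rewrite ger0_norm ?subr_ge0// ger0_norm; lra.
have G1 : G 1 = fine (mu A).
  rewrite /G /C; congr (fine (mu _)); apply/seteqP; split=> [t []//|t At].
  split=> //=; rewrite in_itv/=.
  by move/AI: At; rewrite unit_itvE => /andP[].
(* The start [-1] lies to the left of [[0, 1]], so no point of [A] is collected yet. *)
have G0 : G (- 1) = 0.
  rewrite /G /C (_ : _ `&` _ = set0) ?measure0//.
  apply/seteqP; split=> // t [/AI]; rewrite unit_itvE /= in_itv/= => /andP[? _] ?.
  by exfalso; lra.
have fA : 0 <= fine (mu A) by exact: fine_ge0.
have [|||c _ Gc] := @IVT R G (- 1) 1 (fine (mu A) / 2).
- by lra.
- exact: continuous_subspaceT.
- by rewrite G1 G0 min_l// max_r//; apply/andP; split; lra.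
exists (C c); split=> //; first by move=> t [].
rewrite measureD; [|exact: mA|exact: mC|by rewrite ltey_eq muA].
have -> : A `&` C c = C c by apply/seteqP; split=> [t []//|t [At ct]]; split.
rewrite -[LHS]fineK// [fine _]Gc.
transitivity (fine (mu A) - fine (mu (C c)))%:E; last by rewrite EFinB !fineK.
by rewrite [fine (mu (C c))]Gc; congr EFin; lra.
Qed.

(** Discards the endpoint, where [flip] changes no digit. *)
Lemma ae01_neq1 : ae01 (fun t : R => t <> 1).
Proof.
exists [set 1]; split; first exact: measurable_set1.
  exact: lebesgue_measure_set1.
by move=> t /= /not_implyP[_ /contrapT].
Qed.

Context {E : completeNormedModType R}.
Variable fn : E -> R -> R.
Hypotheses (riE : ri_space fn) (ocE : order_continuous fn).
Let kE := ri_kothe riE.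
Let ind := indicator fn.
Let indP A : measurable A -> represents fn (ind A) \1_A.
Proof. exact: indicatorP. Qed.
Implicit Types x : E.

Lemma integral_indicB A B x : measurable A -> measurable B ->
  A `<=` I01 -> B `<=` I01 -> mu A = mu B ->
  represents fn x (fun t => \1_A t - \1_B t) ->
  (\int[mu]_(t in I01) (fn x t)%:E = 0)%E.
Proof.
move=> mA mB AI BI AB [mf xf]; have mI := @measurable_unit_itv R.
transitivity (\int[mu]_(t in I01) ((\1_A t)%:E - (\1_B t)%:E))%E.
  apply: ae_eq_integral => //.
  - by apply/measurable_EFinP; exact: measurable_fn.
  - exact/measurable_EFinP.
  - by apply: ae01S xf => t _ ->.
have intI C : measurable C -> C `<=` I01 -> mu.-integrable I01 (EFin \o \1_C).
  move=> mC CI; apply/integrableP; split.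
    by apply/measurable_EFinP; exact: measurable_indic.
  under eq_integral => t _ do rewrite gee0_abs ?lee_fin//.
  by rewrite integral_indic// setIidl// ltey_eq lebesgue_measure_fin.
rewrite integralB_EFin ?intI// !integral_indic// !setIidl//.
transitivity (mu A - mu B)%E => //.
by rewrite AB subee// lebesgue_measure_fin.
Qed.

Lemma indicator_gt0 A : measurable A -> A `<=` I01 -> (0 < mu A)%E -> 0 < `|ind A|.
Proof.
move=> mA AI; rewrite normr_gt0; apply: contraTneq => A0.
have [_ aeA] := indP mA; rewrite A0 in aeA; have [_ ae0] := represents0 kE.
have : ae01 (fun t => ~ A t).
  apply: ae01S2 aeA ae0 => t _ -> + At; rewrite indicE mem_set// => /eqP.
  by rewrite oner_eq0.
case=> N [mN muN subN].
have -> : mu A = 0%E; last by rewrite ltxx.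
apply: (@subset_measure0 _ _ _ mu _ _ mA mN _ muN) => t At.
by apply: subN => /= /(_ (AI _ At)).
Qed.

(** * Contractions invariant under flips of even positions *)

Section kernel.
Variable K : {linear E -> E}.
Hypotheses (K_le : forall x, `|K x| <= `|x|)
           (K_flip : forall k x, K (flip_op fn k.*2 x) = K x).

(** Invariance gives [K x = - K x]. *)
Lemma kernel_flip_antisym k x : flip_op fn k.*2 x = - x -> K x = 0.
Proof.
move=> Fx; have := K_flip k x; rewrite Fx linearN => /eqP.
by rewrite eq_sym -subr_eq0 opprK -mulr2n -scaler_nat scaler_eq0 pnatr_eq0 => /eqP.
Qed.

(* On the part of [A] invariant under the flip of a digit [p] beyond those
   needed to approximate [A], take the [p]-th Rademacher function, which [K]
   annihilates; the remaining part of [A] has small norm. *)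
Lemma kernel_narrow : narrow fn K.
Proof.
move=> A mA AI e e0; have mI := @measurable_unit_itv R.
have [s [m _ ms] As] := dense_fixed_from riE ocE (ind A) (divr_gt0 e0 (ltr0Sn R 1)).
(* The position is even, so [K] ignores its flip, and it is at least [m], so the flip fixes [s]. *)
pose p := m.*2; have Fs : flip_op fn p s = s by apply: ms; rewrite /p; lia.
have [A0 mA0 A0E] : exists2 A0 : set R, measurable A0 &
    forall t, A0 t <-> [/\ A t, A (flip p t) & 0 <= t < 1].
  exists (A `&` flip p @^-1` A `&` `[0, 1[%classic).
    apply: measurableI; last exact: measurable_itv.
    apply: measurableI => //; rewrite -[X in measurable X]setTI.
    exact: measurable_flip.
  by move=> t; rewrite /setI /= in_itv/=; split=> [[[]]|[]].
have mA' : measurable (A `\` A0) by exact: measurableD.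
have mD := @measurable_digit_set R p.
set D := [set t | digit p t] in mD.
(* The rest of [A] is cut into two parts of equal measure, to carry the signs 1 and -1, so that the
   integral vanishes. *)
have [|C [mC CA' muC]] := halving_set mA'; first by move=> t [/AI].
pose Bp := A0 `&` D `|` C; pose Bn := A0 `\` D `|` (A `\` A0) `\` C.
have mA0D : measurable (A0 `&` D) by exact: measurableI.
have mA0D' : measurable (A0 `\` D) by exact: measurableD.
have mA'C : measurable ((A `\` A0) `\` C) by exact: measurableD.
have mBp : measurable Bp by exact: measurableU.
have mBn : measurable Bn by exact: measurableU.
have A0I : A0 `<=` I01 by move=> t /A0E[/AI].
have BpI : Bp `<=` I01 by move=> t [[/A0I]|/CA'[/AI]].
have BnI : Bn `<=` I01 by move=> t [[/A0I]|[[/AI]]].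
pose y := ind (A0 `&` D) - ind (A0 `\` D).
pose z := ind C - ind ((A `\` A0) `\` C).
have yP : represents fn y _ := representsB kE (indP mA0D) (indP mA0D').
have zP : represents fn z _ := representsB kE (indP mC) (indP mA'C).
have dE t : 0 <= t < 1 -> (A0 `\` D) (flip p t) <-> (A0 `&` D) t.
  move=> t01; rewrite /setD /setI /D /= !A0E flipK flip_inE digit_flip// eqxx addbT.
  split=> [[[]] ? ? _ /negP|[[]] ? ? _ dt]; first by rewrite negbK.
  by split=> //; rewrite dt.
have dE' t : 0 <= t < 1 -> (A0 `&` D) (flip p t) <-> (A0 `\` D) t.
  by move=> t01; rewrite -{2}(flipK p t) dE// flip_itv.
have CM t : t \in C -> t \in A /\ (t \in A0) = false.
  by move=> /set_mem/CA'[At nA0t]; rewrite mem_set// memNset.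
exists (y + z); split.
- have [_ yz] := representsD kE yP zP.
  apply: ae01S yz => t _ ->; rewrite !indicE !in_setD !in_setI.
  have [Ct|nCt] := boolP (t \in C).
    have [-> ->] := CM t Ct.
    by rewrite /= !subr0 add0r expr1n.
  rewrite /= !(andbT, sub0r).
  have [A0t|nA0t] := boolP (t \in A0).
    have [-> _ _] : [/\ t \in A, A (flip p t) & 0 <= t < 1].
      by have /A0E[/mem_set] : A0 t by exact: set_mem.
    by case: (t \in D); rewrite /= ?(subr0, sub0r, addr0, oppr0, sqrrN) expr1n.
  by case: (t \in A); rewrite /= ?(subr0, sub0r, add0r, oppr0, sqrrN) ?expr1n ?expr0n.
- apply: (integral_indicB mBp mBn) => //.
    transitivity (mu (A0 `&` D) + mu C)%E.
      apply: measureU => //.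
      by apply/seteqP; split=> // t [[A0t _] /CA'[_ nA0t]].
    transitivity (mu (A0 `\` D) + mu ((A `\` A0) `\` C))%E; last first.
      apply/esym/measureU => //.
      by apply/seteqP; split=> // t [[A0t _] [[_ nA0t] _]].
    rewrite -muC; congr (_ + _)%E.
    have [_ _ _ mu_flip] := @mp_flip R p.
    transitivity (mu (I01 `&` flip p @^-1` (A0 `\` D))); last first.
      by apply: mu_flip => // t [/A0I].
    congr (mu _); apply/seteqP; split=> t.
      move=> A0Dt; split; first by case: A0Dt => /A0I.
      by apply/dE => //; case: A0Dt => /A0E[].
    by move=> [_ /= H]; apply/dE => //; case: H => /A0E[_ _]; rewrite flip_inE.
  apply: (represents_ae (representsD kE yP zP)).
    by apply: measurable_funB; exact: measurable_indic.
  apply: ae01W => t _; rewrite /Bp /Bn !indicE !in_setU !in_setD !in_setI.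
  have [Ct|nCt] := boolP (t \in C).
    have [-> ->] := CM t Ct.
    by rewrite /= !subr0 add0r.
  have [A0t|nA0t] := boolP (t \in A0).
    have -> : t \in A by have /A0E[/mem_set] : A0 t by exact: set_mem.
    by case: (t \in D); rewrite /= ?(subr0, sub0r, addr0, oppr0).
  by case: (t \in A); rewrite /= ?(subr0, sub0r, add0r, oppr0).
- have Ky : K y = 0.
    apply: (@kernel_flip_antisym m); rewrite -/p.
    apply: (represents_unique kE (composition_represents riE (mp_flip p) yP)).
    rewrite -scaleN1r; apply: (represents_ae (representsZ kE (-1) yP)).
      have [[tauI _ _] mflip _ _] := @mp_flip R p.
      apply: (measurable_comp mI) => //; first by move=> _ [t It <-]; exact: tauI.
      by apply: measurable_funB; exact: measurable_indic.
    apply: ae01S ae01_neq1 => t; rewrite unit_itvE => /andP[t0 t1] /eqP t1'.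
    have t01 : 0 <= t < 1 by rewrite t0 lt_neqAle t1'.
    have e1 : (flip p t \in A0 `\` D) = (t \in A0 `&` D).
      by apply/idP/idP => /set_mem/dE /mem_set; exact.
    have e2 : (flip p t \in A0 `&` D) = (t \in A0 `\` D).
      by apply/idP/idP => /set_mem/dE' /mem_set; exact.
    by rewrite /= !indicE e1 e2 mulN1r opprB.
  rewrite linearD Ky add0r; apply: le_lt_trans (K_le z) _.
  (* The modulus of [z] is the indicator of the points of [A] outside [A0]. Almost all of these
     leave [A] under the flip, which gives this bound; as the flip fixes [s], it is at most twice
     the distance from [ind A] to [s]. *)
  apply: (@le_lt_trans _ _ `|ind A - flip_op fn p (ind A)|).
    have fA := composition_represents riE (mp_flip p) (indP mA).
    apply: (represents_le kE zP (representsB kE (indP mA) fA)).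
    apply: ae01S ae01_neq1 => t; rewrite unit_itvE => /andP[t0 t1] /eqP t1'.
    have t01 : 0 <= t < 1 by rewrite t0 lt_neqAle t1'.
    have A'E : t \in A `\` A0 -> t \in A /\ flip p t \notin A.
      move=> /set_mem[At nA0t]; split; first exact: mem_set.
      by apply/negP => /set_mem fAt; apply: nA0t; apply/A0E.
    rewrite /= !indicE in_setD.
    have [Ct|nCt] := boolP (t \in C).
      have [-> /negbTE ->] := A'E (mem_set (CA' _ (set_mem Ct))).
      by rewrite andbF.
    have [A't|nA't] := boolP (t \in A `\` A0).
      by have [-> /negbTE ->] := A'E A't; rewrite /= sub0r subr0 normrN.
    by rewrite /= subrr normr0.
  have [linF nF] : linear (flip_op fn p) /\ forall x, `|flip_op fn p x| <= `|x|.
    split; first exact: (linear_composition riE (mp_flip p)).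
    by move=> x; rewrite (norm_composition riE x (mp_flip p)).
  have := contractive_dist (ind A) s linF nF.
  rewrite Fs => fAs.
  rewrite -(subrK s (ind A)) -addrA; apply: le_lt_trans (ler_normD _ _) _.
  rewrite subrK [X in _ + X]distrC; lra.
Qed.

(** [K] does not see the averaging of digit 0. Flipping that digit moves [A] off itself, so at
    almost every point at most one of the two terms of the mean is nonzero, and it has modulus 1. *)
Lemma kernel_half_ball A x (b : bool) :
  (forall t, A t -> digit 0 t = b) ->
  ae_eq mu I01 (fun t => fn x t ^+ 2) \1_A ->
  (forall y, sup_ball fn 2^-1 y -> sup_ball fn 2^-1 (K y)) ->
  sup_ball fn 2^-1 (K x).
Proof.
move=> Ab xA KB.
have -> : K x = K (flip_mean (flip_op fn) 0 x).
  rewrite /flip_mean linearZ linearD /= (K_flip 0) -{2 3}[K x]scale1r -scalerDl.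
  by rewrite scalerA -[1 + 1]/2%:R mulVf ?scale1r// pnatr_eq0.
apply: KB.
have m0 := @mp_flip R 0; have xf := represents_fn kE x.
apply: (sup_ballP (representsZ kE _ (representsD kE xf
  (composition_represents riE m0 xf)))).
apply: ae01S3 xA (ae01_comp m0 xA) ae01_neq1 => t.
rewrite unit_itvE => /andP[t0 t1] + + /eqP t1'.
have t01 : 0 <= t < 1 by rewrite t0 lt_neqAle t1'.
have sq (B : set R) u (r : R) : r ^+ 2 = \1_B u -> `|r| = \1_B u.
  move=> r2; have : `|r| ^+ 2 = (\1_B u) ^+ 2.
    rewrite real_normK ?num_real// r2 !indicE.
    by case: (u \in B); rewrite ?expr1n ?expr0n.
  by move/eqP; rewrite eqrXn2 ?indicE ?ler0n// => /eqP.
move=> /sq xt /sq /= xft.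
rewrite normrM ger0_norm ?invr_ge0// -[leRHS]mulr1 ler_pM2l ?invr_gt0//.
apply: le_trans (ler_normD _ _) _; rewrite xt /= xft !indicE -natrD lern1.
have [At|] := boolP (t \in A); last by move=> _; case: (_ \in A).
have [/set_mem/Ab|] := boolP (flip 0 t \in A); last by [].
by rewrite digit_flip// (Ab _ (set_mem At)) eqxx addbT => nbb; exfalso; case: (b) nbb.
Qed.

End kernel.
End narrowness.

(** * The two projections *)

Unset Implicit Arguments.

Theorem theorem5p8 (R : realType) (E : completeNormedModType R)
    (fn : E -> R -> R) (riE : ri_space fn) (ocE : order_continuous fn) :
  exists E0 : set E,
    [/\ complemented E0,
        isomorphic_subspace E E0 &
        exists P Q : {linear E -> E},
          [/\ projection_onto P E0,
              projection_onto Q E0,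
              narrow fn P &
              forall B : set R, measurable B -> B `<=` I01 ->
                (0 < mu B)%E -> ~ narrow_at fn Q B]].
Proof.
have kE := ri_kothe riE.
have [||||||||||||J [K [nJ nK JK KF CJK]]] :=
  @spread_gather_limits R E (flip_op fn) (exchange_op fn).
- by move=> p; exact: (linear_composition riE (mp_flip p)).
- by move=> p q; exact: (linear_composition riE (mp_exchange p q)).
- by move=> p x; exact: (norm_composition riE x (mp_flip p)).
- by move=> p q x; exact: (norm_composition riE x (mp_exchange p q)).
- by move=> p x; exact: (composition_involutive riE x (mp_flip p) (flipK p)).
- move=> p q x; apply: (composition_comm riE); try exact: mp_flip.
  by move=> t; exact: flipC.
- move=> p q x _.
  exact: (composition_involutive riE x (mp_exchange p q) (exchangeK p q)).
- move=> p q r x pq rp rq.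
  apply: (composition_comm riE); try exact: mp_flip; try exact: mp_exchange.
  by move=> t; exact: exchange_flip.
- move=> p q x pq.
  apply: (composition_comm riE); try exact: mp_flip; try exact: mp_exchange.
  by move=> t; exact: exchange_flipl.
- move=> p q x pq.
  apply: (composition_comm riE); try exact: mp_flip; try exact: mp_exchange.
  by move=> t; exact: exchange_flipr.
- by move=> p q x _; exact: exchange_op_id.
- exact: dense_fixed_from.
(* The radius is the bound that [kernel_half_ball] yields for [K x]; applying [J] then keeps it. *)
have ball_JK x : sup_ball fn 2^-1 x ->
    sup_ball fn 2^-1 (J x) /\ sup_ball fn 2^-1 (K x).
  apply: CJK.
  - by apply: (closed_sup_ball kE); rewrite invr_ge0.
  - exact: (midpoint_convex_sup_ball kE).
  - by move=> p y; exact: (composition_sup_ball riE (mp_flip p)).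
  - by move=> p q y _; exact: (composition_sup_ball riE (mp_exchange p q)).
pose P : {linear E -> E} := J \o K.
pose Q : {linear E -> E} := J \o (K \+ 3 \*: (idfun \- P)).
have QE x : Q x = J (K x + 3 *: (x - J (K x))) by [].
(* The constant is [1 + 3 * 2]: the norm of [K x] is at most that of [x], and the norm of
   [x - J (K x)] at most twice that. *)
have nQ x : `|Q x| <= 7 * `|x|.
  rewrite QE nJ; apply: le_trans (ler_normD _ _) _.
  rewrite normrZ ger0_norm//.
  have := ler_normB x (J (K x)); have := nK x; have := nJ (K x); lra.
have QJ x : Q (J x) = J x by rewrite QE JK subrr scaler0 addr0.
have projP : projection_onto P (range J).
  split.
  - by apply: (@bounded_near_le _ _ _ _ 1) => x; rewrite /= nJ mul1r.
  - by move=> x /=; rewrite JK.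
  - apply/seteqP; split=> [_ [x _ <-]|_ [x _ <-]]; first by exists (K x).
    by exists (J x) => //=; rewrite JK.
have projQ : projection_onto Q (range J).
  split.
  - exact: bounded_near_le nQ.
  - by move=> x; rewrite [Q x]QE QJ.
  - apply/seteqP; split=> [_ [x _ <-]|_ [x _ <-]].
      by rewrite QE; exists (K x + 3 *: (x - J (K x))).
    by exists (J x).
exists (range J); split; first by exists P.
  exists J, K; split=> //.
    apply/linear_bounded_continuous.
    by apply: (@bounded_near_le _ _ _ _ 1) => x; rewrite nJ mul1r.
  apply: continuous_subspaceT; apply/linear_bounded_continuous.
  by apply: (@bounded_near_le _ _ _ _ 1) => x; rewrite mul1r.
exists P, Q; split => //.
  move=> A mA AI e e0; have [x [xA intx Kx]] := kernel_narrow riE ocE nK KF mA AI e0.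
  by exists x; split=> //=; rewrite nJ.
move=> B mB BI muB narrowQ.
have mD := @measurable_digit_set R 0.
(* One of the two parts of [B] on which digit 0 is constant has positive measure. *)
have [b [A [mA AB muA Ab]]] : exists b A, [/\ measurable A, A `<=` B,
    (0 < mu A)%E & forall t, A t -> digit 0 t = b].
  have [BD|BD] := ltP 0%E (mu (B `&` [set t | digit 0 t])).
    exists true, (B `&` [set t | digit 0 t]); split=> //; last by move=> t [].
    exact: measurableI.
  exists false, (B `\` [set t | digit 0 t]); split.
  - exact: measurableD.
  - by move=> t [].
  - have muE : (lebesgue_measure B = lebesgue_measure (B `&` [set t | digit 0 t]) +
        lebesgue_measure (B `\` [set t | digit 0 t]))%E.
      rewrite -measureU;
        [by rewrite setUIDK|exact: measurableI|exact: measurableD|].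
      by apply/seteqP; split=> // t [[_ ?] [_ ?]].
    rewrite muE in muB; apply: (lt_le_trans muB).
    by apply: le_trans (leeD2r _ BD) _; rewrite add0e.
  - by move=> t [_ /negP/negbTE].
have AI : A `<=` unit_itv (R := R) by move=> t /AB/BI.
(* The norm of the indicator of [A] serves as the tolerance; it is a lower bound for the norm of
   [Q x]. *)
have iA := indicator_gt0 riE mA AI muA.
have [x [xA _]] := narrowQ A mA AI _ iA.
apply/negP; rewrite -leNgt.
have sq : ae01 (fun t => [\/ fn x t = 0 /\ \1_A t = 0 :> R,
    fn x t = 1 /\ A t | fn x t = -1 /\ A t]).
  apply: ae01S xA => t _; rewrite indicE; case: (boolP (t \in A)) => At /eqP.
    by rewrite sqrf_eq1 => /orP[] /eqP ->; [apply: Or32|apply: Or33];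
      split=> //; exact: set_mem.
  by rewrite sqrf_eq0 => /eqP ->; apply: Or31.
have xf := represents_fn kE x.
(* Almost everywhere [x] vanishes off [A], which is contained in [B]. *)
have -> : cutoff fn B x = x.
  apply: (represents_unique kE (cutoff_represents x kE mB)).
  apply: (represents_ae xf).
    by apply: measurable_funM; [exact: measurable_fn|exact: measurable_indic].
  apply: ae01S sq => t _ [[-> _]|[_ /AB Bt]|[_ /AB Bt]]; rewrite ?mul0r//;
  by rewrite indicE mem_set// mulr1.
apply: (@le_trans _ _ `|x|).
  apply: (represents_le kE (indicatorP kE mA) xf).
  by apply: ae01S sq => t _ [[-> ->]|[-> At]|[-> At]];
    rewrite ?indicE ?mem_set ?normrN ?normr1 ?normr0.
have Kx : sup_ball fn 2^-1 (K x).
  by apply: (kernel_half_ball riE KF Ab xA) => y /ball_JK[].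
have [JKx _] := ball_JK _ Kx.
rewrite QE nJ.
(* Where [x] is 1 or -1, the modulus of the sum is at least [3 - 1/2 - 3/2 = 1]; this makes 3 the
   least factor for which the estimate works. *)
apply: (represents_le kE xf (representsD kE (represents_fn kE (K x))
  (representsZ kE 3 (representsB kE xf (represents_fn kE (J (K x))))))).
apply: ae01S3 sq Kx JKx => t _ H /ler_normlP[? ?] /ler_normlP[? ?].
case: H => -[-> _].
- by rewrite normr0.
- by rewrite normr1 ler_normr; apply/orP; left; lra.
- by rewrite normrN normr1 ler_normr; apply/orP; right; lra.
Qed.
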